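(* Consider the closed-loop system $$\dot{x}(t)=f(t,x_t,k(x(t)+\epsilon(t))),\qquad x_{t_0}=\varphi,$$ where $\epsilon(t)=x(t_i)-x(t)$ for $t\in[t_i,t_{i+1})$, i.e. the system $\dot x(t)=f(t,x_t,u(t))$ with sampled feedback $u(t)=k(x(t_i))$ on $[t_i,t_{i+1})$, with $f$, $k$, $\varphi$ as in the context. Suppose there exist functions $V_1\in\mathcal{V}_0$, $V_2\in\mathcal{V}_0^*$, $\alpha_1,\alpha_2,\alpha_3\in\mathcal{K}_\infty$, $\chi\in\mathcal{K}$ and a constant $\mu>0$ such that, for all $t\in\mathbb{R}^+$ and $\phi\in\mathcal{C}([-\tau,0],\mathbb{R}^n)$: (i) $\alpha_1(\|\phi(0)\|)\le V_1(t,\phi(0))\le\alpha_2(\|\phi(0)\|)$ and $0\le V_2(t,\phi)\le\alpha_3(\|\phi\|_\tau)$; (ii) $V(t,\phi):=V_1(t,\phi(0))+V_2(t,\phi)$ satisfies, along the closed-loop system, $\mathrm{D}^+V(t,\phi)\le-\mu V(t,\phi)+\chi(\|\epsilon\|)$. Let the event times be defined, starting from the initial time $t_0$, by $$t_{i+1}=\inf\left\{t\ge t_i \;\middle|\; \chi(\|\epsilon(t)\|)=\sigma\,\alpha_1(\|x(t)\|)+\chi\left(a e^{-b(t-t_0)}\right)\right\},$$ with constants $0\le\sigma<\mu$, $a>0$ and $b>0$. Assume further that (iii) $\alpha_1^{-1}$, $\chi$ and $k$ are locally Lipschitz, where $\alpha_1^{-1}$ denotes the inverse of $\alpha_1$;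 (iv) $f$ is locally Lipschitz in its second and third arguments, respectively. Then the closed-loop system is globally asymptotically stable and does not exhibit Zeno behavior.
   Context: Notation: $\mathbb{R}^+=[0,\infty)$; $\|\cdot\|$ is the Euclidean norm; $\tau>0$ is the maximum delay; $\mathcal{C}(J,\mathbb{R}^n)$ is the set of continuous functions from an interval $J$ to $\mathbb{R}^n$; $\mathcal{C}([-\tau,0],\mathbb{R}^n)$ carries the norm $\|\phi\|_\tau=\sup_{s\in[-\tau,0]}\|\phi(s)\|$; $x_t(s):=x(t+s)$ for $s\in[-\tau,0]$. System data: $x(t)\in\mathbb{R}^n$, $u(t)\in\mathbb{R}^m$; $t_0$ is the initial time and $\varphi\in\mathcal{C}([-\tau,0],\mathbb{R}^n)$ the initial function; $f:\mathbb{R}^+\times\mathcal{C}([-\tau,0],\mathbb{R}^n)\times\mathbb{R}^m\to\mathbb{R}^n$ satisfies $f(t,0,0)=0$ for all $t\in\mathbb{R}^+$; the feedback law $k:\mathbb{R}^n\to\mathbb{R}^m$ satisfies $k(0)=0$. Function classes: $\alpha\in\mathcal{K}$ if $\alpha$ on $\mathbb{R}^+$ is continuous, strictly increasing, and $\alpha(0)=0$; $\alpha\in\mathcal{K}_\infty$ if in addition $\alpha(s)\to\infty$ as $s\to\infty$. $V_1:\mathbb{R}^+\times\mathbb{R}^n\to\mathbb{R}^+$ is in $\mathcal{V}_0$ if for each $x\in\mathcal{C}(\mathbb{R}^+,\mathbb{R}^n)$ the map $t\mapsto V_1(t,x(t))$ is continuous. $V_2:\mathbb{R}^+\times\mathcal{C}([-\tau,0],\mathbb{R}^n)\to\mathbb{R}^+$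 is in $\mathcal{V}_0^*$ if for each $x\in\mathcal{C}([-\tau,\infty),\mathbb{R}^n)$ the map $t\mapsto V_2(t,x_t)$ is continuous for all $t\ge0$, and $V_2$ is locally Lipschitz in its second argument. Dini derivative along the system: $\mathrm{D}^+V(t,\phi)=\limsup_{h\to0^+}\frac{V(t+h,x_{t+h}(t,\phi))-V(t,\phi)}{h}$, where $x(t,\phi)$ denotes the solution of the system satisfying $x_t=\phi$. Stability notions: the system is globally asymptotically stable if its zero solution is stable (for every $\varepsilon>0$ there is $\delta>0$ such that $\|\varphi\|_\tau<\delta$ implies $\|x(t)\|<\varepsilon$ for all $t\ge t_0$) and globally attractive ($\lim_{t\to\infty}\|x(t)\|=0$ for every initial function $\varphi\in\mathcal{C}([-\tau,0],\mathbb{R}^n)$). Zeno behavior means that infinitely many event times $t_i$ occur over a finite time interval.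
   Formalization: In (iv), f is taken Lipschitz on bounded sets, uniformly for t in compact intervals and over the other argument on bounded sets (with constants only near each point the claim fails); local existence of the solution x(t,φ) with held sample is an explicit assumption. *)

(* Defs.v *)
(* Library: MathComp + MathComp-Analysis, over an arbitrary R : realType. *)
From HB Require Import structures.
From mathcomp Require Import all_boot all_order all_algebra.
From mathcomp Require Import all_classical all_reals all_analysis.

Set Implicit Arguments.
Unset Strict Implicit.
Unset Printing Implicit Defensive.

Import Order.TTheory GRing.Theory Num.Theory.
Import numFieldNormedType.Exports.

Local Open Scope classical_set_scope.
Local Open Scope ring_scope.

(* The canonical norm of 'rV[R]_n is the sup norm; it induces the same topology
   as the Euclidean norm used here. *)
Definition enorm (R : realType) (n : nat) (x : 'rV[R]_n) : R :=
  Num.sqrt (\sum_(j < n) x ord0 j ^+ 2).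

(* C([-tau,0],R^n).  Each continuous function on [-tau,0] is represented by its
   extension by 0 to R, so that equality in Cseg is equality on [-tau,0] and
   functionals on Cseg see nothing outside [-tau,0]. *)
Definition Cseg (R : realType) (n : nat) (tau : R) : set (R -> 'rV[R]_n) :=
  [set phi : R -> 'rV[R]_n |
     {within `[- tau, 0]%classic, continuous phi} /\
     forall s : R, s \notin `[- tau, 0] -> phi s = 0].

Definition tnorm (R : realType) (n : nat) (tau : R) (phi : R -> 'rV[R]_n) : R :=
  sup [set enorm (phi s) | s in `[- tau, 0]%classic].

(* x_t, as an element of Cseg *)
Definition hist (R : realType) (n : nat) (tau : R) (x : R -> 'rV[R]_n) (t : R) :
    R -> 'rV[R]_n :=
  patch (fun=> 0) `[- tau, 0]%classic (fun s => x (t + s)).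

(* Functions on R^+ are total functions on R whose values on negative numbers
   are irrelevant. *)
Definition classK (R : realType) (alpha : R -> R) : Prop :=
  [/\ {within `[0, +oo[%classic, continuous alpha},
      {in `[0, +oo[ &, {homo alpha : s t / s < t}} &
      alpha 0 = 0].

Definition classKinf (R : realType) (alpha : R -> R) : Prop :=
  classK alpha /\ alpha s @[s --> +oo%R] --> +oo%R.

(* For alpha of class Kinf this is the inverse of alpha : R^+ -> R^+. *)
Definition Kinv (R : realType) (alpha : R -> R) : R -> R :=
  'pinv_(fun=> 0) `[0, +oo[%classic alpha.

Definition locally_lipschitz (R : realType) (U W : zmodType)
    (normU : U -> R) (normW : W -> R) (D : set U) (g : U -> W) : Prop :=
  forall u, D u -> exists2 r, 0 < r & exists L, forall v w,
    D v -> D w -> normU (v - u) < r -> normU (w - u) < r ->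
    normW (g v - g w) <= L * normU (v - w).

Definition classV0 (R : realType) (n : nat) (V1 : R -> 'rV[R]_n -> R) : Prop :=
  (forall t y, 0 <= t -> 0 <= V1 t y) /\
  (forall x : R -> 'rV[R]_n, {within `[0, +oo[%classic, continuous x} ->
     {within `[0, +oo[%classic, continuous (fun t => V1 t (x t))}).

Definition classV0star (R : realType) (n : nat) (tau : R)
    (V2 : R -> (R -> 'rV[R]_n) -> R) : Prop :=
  [/\ forall t phi, 0 <= t -> Cseg tau phi -> 0 <= V2 t phi,
      forall x : R -> 'rV[R]_n, {within `[- tau, +oo[%classic, continuous x} ->
        {within `[0, +oo[%classic, continuous (fun t => V2 t (hist tau x t))} &
      forall t, 0 <= t ->
        locally_lipschitz (tnorm tau) Num.norm (Cseg tau) (V2 t)].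

(* Local Lipschitz continuity of the right-hand side is meant on bounded sets,
   uniformly for t in compact intervals: closed balls of C([-tau,0],R^n) are
   not compact, and Lipschitz continuity near each point would not even bound f
   on bounded sets (nor exclude Zeno behavior). *)
Definition lipschitz_in_state (R : realType) (n m : nat) (tau : R)
    (f : R -> (R -> 'rV[R]_n) -> 'rV[R]_m -> 'rV[R]_n) : Prop :=
  forall B r : R, exists L, forall t phi psi u,
    0 <= t <= B -> Cseg tau phi -> Cseg tau psi ->
    tnorm tau phi <= r -> tnorm tau psi <= r -> enorm u <= r ->
    enorm (f t phi u - f t psi u) <= L * tnorm tau (phi - psi).

Definition lipschitz_in_input (R : realType) (n m : nat) (tau : R)
    (f : R -> (R -> 'rV[R]_n) -> 'rV[R]_m -> 'rV[R]_n) : Prop :=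
  forall B r : R, exists L, forall t phi u v,
    0 <= t <= B -> Cseg tau phi ->
    tnorm tau phi <= r -> enorm u <= r -> enorm v <= r ->
    enorm (f t phi u - f t phi v) <= L * enorm (u - v).

(* A dotted state is a right-hand derivative, as needed at sampling times. *)
Definition has_rderiv (R : realType) (n : nat) (x : R -> 'rV[R]_n) (t : R)
    (v : 'rV[R]_n) : Prop :=
  h^-1 *: (x (t + h) - x t) @[h --> 0^'+] --> v.

(* epsilon(t), with xi = x(t_i) the last sampled state *)
Definition sampling_error (R : realType) (n : nat) (xi : 'rV[R]_n)
    (x : R -> 'rV[R]_n) (t : R) : 'rV[R]_n := xi - x t.

Definition closed_loop_eq (R : realType) (n m : nat) (tau : R)
    (f : R -> (R -> 'rV[R]_n) -> 'rV[R]_m -> 'rV[R]_n)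
    (k : 'rV[R]_n -> 'rV[R]_m) (xi : 'rV[R]_n) (x : R -> 'rV[R]_n) (t : R) :
    Prop :=
  has_rderiv x t (f t (hist tau x t) (k (x t + sampling_error xi x t))).

(* x solves the closed-loop system on [t, T[ between two consecutive events,
   with sampled state xi and x_t = phi. *)
Definition held_solution (R : realType) (n m : nat) (tau : R)
    (f : R -> (R -> 'rV[R]_n) -> 'rV[R]_m -> 'rV[R]_n)
    (k : 'rV[R]_n -> 'rV[R]_m) (xi : 'rV[R]_n) (t : R) (phi : R -> 'rV[R]_n)
    (T : R) (x : R -> 'rV[R]_n) : Prop :=
  [/\ t < T,
      {within `[t - tau, T[%classic, continuous x},
      hist tau x t = phi &
      forall s, t <= s -> s < T -> closed_loop_eq tau f k xi x s].

(* Existence of the solution x(t, phi) on which D^+V(t, phi) is computed *)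
Definition locally_solvable (R : realType) (n m : nat) (tau : R)
    (f : R -> (R -> 'rV[R]_n) -> 'rV[R]_m -> 'rV[R]_n)
    (k : 'rV[R]_n -> 'rV[R]_m) : Prop :=
  forall t phi xi, 0 <= t -> Cseg tau phi ->
    exists T x, held_solution tau f k xi t phi T x.

Definition upper_dini (R : realType) (n : nat) (tau : R)
    (V : R -> (R -> 'rV[R]_n) -> R) (x : R -> 'rV[R]_n) (t : R) : \bar R :=
  limf_esup (fun h : R =>
    ((V (t + h) (hist tau x (t + h)) - V t (hist tau x t)) / h)%:E) 0^'+.

(* D^+V(t,phi) <= -mu V(t,phi) + chi(|epsilon|) along the closed-loop system.
   The segment phi does not determine the last sampled state (which may be older
   than tau), so xi, equivalently epsilon(t) = xi - phi(0), is arbitrary. *)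
Definition dissipation (R : realType) (n m : nat) (tau : R)
    (f : R -> (R -> 'rV[R]_n) -> 'rV[R]_m -> 'rV[R]_n)
    (k : 'rV[R]_n -> 'rV[R]_m) (V : R -> (R -> 'rV[R]_n) -> R)
    (mu : R) (chi : R -> R) : Prop :=
  forall t phi xi T x, 0 <= t -> Cseg tau phi ->
    held_solution tau f k xi t phi T x ->
    (upper_dini tau V x t <=
      (- mu * V t phi + chi (enorm (sampling_error xi x t)))%:E)%E.

Definition trigger (R : realType) (n : nat) (alpha1 chi : R -> R)
    (sigma a b t0 t : R) (e y : 'rV[R]_n) : Prop :=
  chi (enorm e) = sigma * alpha1 (enorm y) + chi (a * expR (- b * (t - t0))).

(* The event times t_0 < t_1 < ... of a trajectory x defined for t < T:
   t_{i+1} is the infimum of the t >= t_i at which tr t epsilon(t) x(t) holds,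
   epsilon being computed with the sample x(t_i).  There is no event number i
   when t_i = +oo. *)
Fixpoint event_time (R : realType) (n : nat)
    (tr : R -> 'rV[R]_n -> 'rV[R]_n -> Prop) (t0 : R) (T : \bar R)
    (x : R -> 'rV[R]_n) (i : nat) : \bar R :=
  if i is j.+1 then
    let tj := event_time tr t0 T x j in
    ereal_inf [set t%:E | t in [set t : R |
      [/\ (tj <= t%:E)%E, (t%:E < T)%E &
          tr t (sampling_error (x (fine tj)) x t) (x t)]]]
  else t0%:E.

(* x is a solution on [t0, T[ of the event-triggered closed-loop system; T may
   be the finite limit of infinitely many event times. *)
Definition solution (R : realType) (n m : nat) (tau : R)
    (f : R -> (R -> 'rV[R]_n) -> 'rV[R]_m -> 'rV[R]_n)
    (k : 'rV[R]_n -> 'rV[R]_m) (tr : R -> 'rV[R]_n -> 'rV[R]_n -> Prop)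
    (t0 : R) (phi : R -> 'rV[R]_n) (T : \bar R) (x : R -> 'rV[R]_n) : Prop :=
  [/\ (t0%:E < T)%E,
      {within [set t : R | t0 - tau <= t /\ (t%:E < T)%E], continuous x},
      hist tau x t0 = phi &
      forall t : R, t0 <= t -> (t%:E < T)%E ->
        exists i, let ti := event_time tr t0 T x i in
          (ti <= t%:E < event_time tr t0 T x i.+1)%E /\
          closed_loop_eq tau f k (x (fine ti)) x t].

Definition maximal_solution (R : realType) (n m : nat) (tau : R)
    (f : R -> (R -> 'rV[R]_n) -> 'rV[R]_m -> 'rV[R]_n)
    (k : 'rV[R]_n -> 'rV[R]_m) (tr : R -> 'rV[R]_n -> 'rV[R]_n -> Prop)
    (t0 : R) (phi : R -> 'rV[R]_n) (T : \bar R) (x : R -> 'rV[R]_n) : Prop :=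
  solution tau f k tr t0 phi T x /\
  forall T' x', solution tau f k tr t0 phi T' x' -> (T <= T')%E ->
    (forall t : R, t0 - tau <= t -> (t%:E < T)%E -> x' t = x t) -> T' = T.

Definition forward_complete (R : realType) (n m : nat) (tau : R)
    (f : R -> (R -> 'rV[R]_n) -> 'rV[R]_m -> 'rV[R]_n)
    (k : 'rV[R]_n -> 'rV[R]_m) (tr : R -> 'rV[R]_n -> 'rV[R]_n -> Prop)
    (t0 : R) : Prop :=
  forall phi, Cseg tau phi ->
    (exists x, solution tau f k tr t0 phi +oo%E x) /\
    (forall T x, maximal_solution tau f k tr t0 phi T x -> T = +oo%E).

Definition stable (R : realType) (n m : nat) (tau : R)
    (f : R -> (R -> 'rV[R]_n) -> 'rV[R]_m -> 'rV[R]_n)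
    (k : 'rV[R]_n -> 'rV[R]_m) (tr : R -> 'rV[R]_n -> 'rV[R]_n -> Prop)
    (t0 : R) : Prop :=
  forall eps, 0 < eps -> exists2 delta, 0 < delta &
    forall phi, Cseg tau phi -> tnorm tau phi < delta ->
    forall T x, solution tau f k tr t0 phi T x ->
    forall t, t0 <= t -> (t%:E < T)%E -> enorm (x t) < eps.

Definition globally_attractive (R : realType) (n m : nat) (tau : R)
    (f : R -> (R -> 'rV[R]_n) -> 'rV[R]_m -> 'rV[R]_n)
    (k : 'rV[R]_n -> 'rV[R]_m) (tr : R -> 'rV[R]_n -> 'rV[R]_n -> Prop)
    (t0 : R) : Prop :=
  forall phi, Cseg tau phi ->
  forall x, solution tau f k tr t0 phi +oo%E x ->
    enorm (x t) @[t --> +oo%R] --> (0 : R).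

Definition globally_asymptotically_stable (R : realType) (n m : nat) (tau : R)
    (f : R -> (R -> 'rV[R]_n) -> 'rV[R]_m -> 'rV[R]_n)
    (k : 'rV[R]_n -> 'rV[R]_m) (tr : R -> 'rV[R]_n -> 'rV[R]_n -> Prop)
    (t0 : R) : Prop :=
  [/\ forward_complete tau f k tr t0,
      stable tau f k tr t0 &
      globally_attractive tau f k tr t0].

Definition zeno (R : realType) (n : nat)
    (tr : R -> 'rV[R]_n -> 'rV[R]_n -> Prop) (t0 : R) (T : \bar R)
    (x : R -> 'rV[R]_n) : Prop :=
  exists B : R, infinite_set [set i | (event_time tr t0 T x i <= B%:E)%E].

(* Main.v *)
Require Import Defs.
From mathcomp Require Import all_boot all_order all_algebra.
From mathcomp Require Import all_classical all_reals all_analysis.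
From mathcomp Require Import ring lra.
Import Order.TTheory GRing.Theory Num.Theory.
Import numFieldNormedType.Exports.
Local Open Scope classical_set_scope.
Local Open Scope ring_scope.

(** Let [W t] be the value of [V1 + V2] along a trajectory. At a sampling time the
    error vanishes while the right-hand side of the triggering rule,
    [sigma * alpha1 (enorm (x t)) + chi (a * expR (- b * (t - t0)))], is positive;
    so until the next event [chi] of the error stays below it ([error_le]). As
    [alpha1 (enorm (x t)) <= W t], the dissipation inequality becomes
    [D^+ W <= - (mu - sigma) * W + chi (a * expR (- b * (t - t0)))]
    ([lyapunov_growth]), an inequality without error term and with a forcing, the
    function [threshold], that decreases to 0.

    - Boundedness. [W] cannot leave a sublevel set on whose boundary dissipation
      beats the forcing ([lyapunov_invariant]); so every trajectory is bounded, and
      by the growth bounds on [f] and [k] it is Lipschitz on bounded time intervals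
      ([trajectory_lipschitz]).

    - No Zeno behavior. Before time [B] an event requires an error of at least
      [a * expR (- b * (B - t0))], which a Lipschitz trajectory only reaches after
      a minimal time ([event_gap]).

    - Completeness. A solution on a finite interval [t0, T[ is Lipschitz, hence has
      a limit at [T], and it has finitely many events; so there is a last sample,
      and the solution can be restarted from [T] ([restart], [extend_solution]).
      Zorn's lemma then yields a solution for all times ([global_existence]).

    - Attractivity. Once the forcing is small, [W] decreases at a fixed rate as long
      as it exceeds a given level, and it cannot return above that level
      ([event_triggered_attractive]).

    - Stability. The forcing does not become small with the initial data, so the
      inequality for [W] alone is not enough. But 0 is an equilibrium of the sampled
      system, and small initial data give a state that is small for as long as
      desired ([small_initial_data], a Gronwall argument); after that time the
      forcing is negligible and the sublevel sets of [W] take over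
      ([event_triggered_stable]).

    All the differential inequalities hold for right derivatives or upper right
    Dini derivatives only, and are integrated by induction on the real line
    ([real_induction], [nonneg_propagation]). *)

Set Implicit Arguments.
Unset Strict Implicit.
Unset Printing Implicit Defensive.

(** * The Euclidean norm *)

Section EuclideanNorm.
Variables (R : realType) (n : nat).
Implicit Types x y : 'rV[R]_n.

Lemma enorm_ge0 x : 0 <= enorm x.
Proof. exact: sqrtr_ge0. Qed.

Lemma sqr_enorm x : enorm x ^+ 2 = \sum_(j < n) x ord0 j ^+ 2.
Proof. by rewrite sqr_sqrtr//; apply: sumr_ge0 => j _; exact: sqr_ge0. Qed.

Lemma enormZ c x : enorm (c *: x) = `|c| * enorm x.
Proof.
rewrite -sqrtr_sqr -sqrtrM ?sqr_ge0// mulr_sumr; congr Num.sqrt.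
by apply: eq_bigr => j _; rewrite mxE exprMn.
Qed.

Lemma enorm0 : enorm (0 : 'rV[R]_n) = 0.
Proof. by rewrite -(scale0r 0) enormZ normr0 mul0r. Qed.

Lemma enormN x : enorm (- x) = enorm x.
Proof. by rewrite -scaleN1r enormZ normrN normr1 mul1r. Qed.

Lemma enorm_distC x y : enorm (x - y) = enorm (y - x).
Proof. by rewrite -enormN opprB. Qed.

Lemma coord_le_enorm x j : `|x ord0 j| <= enorm x.
Proof.
rewrite -sqrtr_sqr ler_sqrt; last by apply: sumr_ge0 => i _; exact: sqr_ge0.
by rewrite (bigD1 j)//= lerDl; apply: sumr_ge0 => i _; exact: sqr_ge0.
Qed.

Lemma mx_norm_le_enorm x : `|x| <= enorm x.
Proof.
rewrite [leLHS]/Num.norm /= mx_normrE; apply/bigmax_leP; split;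
  first exact: enorm_ge0.
by case=> i j _ /=; rewrite ord1; exact: coord_le_enorm.
Qed.

Lemma enorm_eq0 x : enorm x = 0 -> x = 0.
Proof.
move=> x0; apply/eqP; rewrite -normr_eq0 eq_le normr_ge0 andbT -x0.
exact: mx_norm_le_enorm.
Qed.

(** The triangle inequality is the Cauchy-Schwarz inequality, which comes from
    expanding the square of [enorm y *: x - enorm x *: y]. *)
Lemma enormD x y : enorm (x + y) <= enorm x + enorm y.
Proof.
have [/eqP/enorm_eq0->|x0] := boolP (enorm x == 0).
  by rewrite add0r enorm0 add0r.
have [/eqP/enorm_eq0->|y0] := boolP (enorm y == 0).
  by rewrite addr0 enorm0 addr0.
have {}x0 : 0 < enorm x by rewrite lt_neqAle eq_sym x0 enorm_ge0.
have {}y0 : 0 < enorm y by rewrite lt_neqAle eq_sym y0 enorm_ge0.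
pose B := \sum_(j < n) x ord0 j * y ord0 j.
have sq u v : enorm (u *: x - v *: y) ^+ 2 =
    u ^+ 2 * enorm x ^+ 2 - 2 * u * v * B + v ^+ 2 * enorm y ^+ 2.
  rewrite !sqr_enorm /B !mulr_sumr -sumrN -!big_split/=.
  by apply: eq_bigr => j _; rewrite !mxE; ring.
have Ble : B <= enorm x * enorm y.
  have := sqr_ge0 (enorm (enorm y *: x - enorm x *: y)); rewrite sq.
  set c := enorm x; set d := enorm y => h.
  have cd : 0 < c * d by rewrite mulr_gt0.
  by rewrite -(ler_pM2l cd); nra.
have := sq 1 (-1); rewrite scale1r scaleN1r opprK => e.
rewrite -(@ler_pXn2r _ 2)// ?nnegrE ?enorm_ge0 ?addr_ge0 ?enorm_ge0// e.
by nra.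
Qed.

Lemma enorm_dist x y : `|enorm x - enorm y| <= enorm (x - y).
Proof.
have h (u v : 'rV[R]_n) : enorm u - enorm v <= enorm (u - v).
  by rewrite lerBlDr; have := enormD (u - v) v; rewrite subrK.
by rewrite ler_norml h andbT lerNl opprB enorm_distC h.
Qed.

Lemma enorm_continuous : continuous (@enorm R n).
Proof.
have sumc : continuous (fun y : 'rV[R]_n => \sum_(j < n) y ord0 j ^+ 2).
  apply: continuous_big => [|j _ y]; first exact: add_continuous.
  apply: (@continuous_comp _ _ _ (fun z : 'rV[R]_n => z ord0 j) (fun z =>
    z ^+ 2)).
    exact: coord_continuous.
  exact: exprn_continuous.
by move=> x; exact: continuous_comp (sumc x) (@sqrt_continuous _ _).
Qed.

Lemma enorm_dist_continuous y : continuous (fun z : 'rV[R]_n => enorm (y - z)).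
Proof.
move=> z; apply: (@continuous_comp _ _ _ (fun u : 'rV[R]_n =>
  y - u) (@enorm R n)).
  by apply: continuousB => //; exact: cst_continuous.
exact: enorm_continuous.
Qed.

(** Continuity in the sup norm and in the Euclidean norm agree: the first norm
    is below the second, and the second is continuous for the first. *)
Lemma within_continuous_enormP (A : set R) (x : R -> 'rV[R]_n) :
  {within A, continuous x} <->
  forall t, A t -> forall e, 0 < e -> exists2 d, 0 < d &
    forall s, A s -> `|s - t| < d -> enorm (x s - x t) < e.
Proof.
rewrite subspace_continuousP; split => [xc t At e e0|xc t At].
  have : enorm (x t - x s) @[s --> within A (nbhs t)] --> (0 : R).
    rewrite -enorm0 -(subrr (x t)).
    exact: cvg_comp (xc t At) (@enorm_dist_continuous (x t) (x t)).
  move/cvgrPdist_lt => /(_ _ e0)[d /= d0 h]; exists d => // s As st.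
  have /= := h s; rewrite distrC => /(_ st As).
  by rewrite sub0r normrN ger0_norm ?enorm_ge0// enorm_distC.
apply/cvgrPdist_lt => e e0; have [d d0 h] := xc t At e e0.
exists d => //= s st As; rewrite distrC.
by apply: le_lt_trans (mx_norm_le_enorm _) _; apply: h => //; rewrite distrC.
Qed.

Lemma within_continuous_enorm_dist (A : set R) (x : R -> 'rV[R]_n) y :
  {within A, continuous x} -> {within A, continuous (fun t => enorm (y - x t))}.
Proof.
rewrite !subspace_continuousP => xc t At.
exact: cvg_comp (xc t At) (@enorm_dist_continuous y (x t)).
Qed.

Lemma within_continuous_enorm (A : set R) (x : R -> 'rV[R]_n) :
  {within A, continuous x} -> {within A, continuous (fun t => enorm (x t))}.
Proof.
rewrite !subspace_continuousP => xc t At.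
exact: cvg_comp (xc t At) (@enorm_continuous (x t)).
Qed.

End EuclideanNorm.

(** * Continuity and induction on the real line *)

Section RealInduction.
Variable R : realType.
Implicit Types (a b s t : R) (P : R -> Prop) (D : R -> R).

Lemma within_continuous_distP (A : set R) D :
  {within A, continuous D} <->
  forall t, A t -> forall e, 0 < e -> exists2 d, 0 < d &
    forall s, A s -> `|s - t| < d -> `|D s - D t| < e.
Proof.
rewrite subspace_continuousP; split => [Dc t At e e0|Dc t At].
  have /cvgrPdist_lt/(_ _ e0)[d /= d0 h] := Dc t At; exists d => // s As st.
  by rewrite distrC; apply: h => //=; rewrite distrC.
apply/cvgrPdist_lt => e e0; have [d d0 h] := Dc t At e e0.
exists d => //= s st As; rewrite distrC.
by apply: h => //; rewrite distrC.
Qed.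

Lemma within_continuousB (A : set R) (g h : R -> R) :
  {within A, continuous g} -> {within A, continuous h} ->
  {within A, continuous (fun t => g t - h t)}.
Proof.
rewrite !subspace_continuousP => gc hc t At.
by apply: cvgB; [exact: gc|exact: hc].
Qed.

Lemma affine_continuous (c a : R) : continuous (fun t : R => c * (t - a)).
Proof.
move=> t; apply: cvgM; first exact: cvg_cst.
by apply: cvgB; [exact: cvg_id|exact: cvg_cst].
Qed.

(** The supremum of the [s] such that [P] holds on [a, s] belongs to that set,
    and the second hypothesis would push it further right if it were below [b]. *)
Lemma real_induction a b P :
  (forall s, a <= s <= b -> (forall r, a <= r -> r < s -> P r) -> P s) ->
  (forall s, a <= s < b -> (forall r, a <= r <= s -> P r) ->
     exists2 d, 0 < d & forall r, s < r < s + d -> r <= b -> P r) ->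
  forall s, a <= s <= b -> P s.
Proof.
move=> left right s /andP[sa sb].
have ab : a <= b := le_trans sa sb.
pose A := [set c | a <= c <= b /\ forall r, a <= r <= c -> P r].
have Aa : A a.
  split; first by rewrite lexx.
  move=> r /andP[ar ra]; have -> : r = a by apply/eqP; rewrite eq_le ar ra.
  apply: left; first by rewrite lexx.
  by move=> u au ua; move: (lt_le_trans ua au); rewrite ltxx.
have supA : has_sup A by split; [exists a|exists b => c [/andP[]]].
pose c := sup A.
have ac : a <= c by apply: ub_le_sup Aa; exact: supA.2.
have cb : c <= b by apply: ge_sup; [exact: supA.1|] => u [/andP[]].
have Pltc r : a <= r -> r < c -> P r.
  move=> ar rc; have [|u [_ Au]] := @sup_adherent _ A (c - r) _ supA.
    by rewrite subr_gt0.
  by rewrite subKr => ru; apply: Au; rewrite ar ltW.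
have Plec r : a <= r <= c -> P r.
  move=> /andP[ar]; rewrite le_eqVlt => /predU1P[->|]; last exact: Pltc.
  by apply: left => //; rewrite ac.
suff bc : b = c by apply: Plec; rewrite sa -bc.
apply/eqP; rewrite eq_le cb andbT leNgt; apply/negP => cltb.
have [|d d0 Pd] := right c _ Plec; first by rewrite ac.
pose e := Num.min b (c + d / 2).
have ce : c < e by rewrite lt_min cltb ltrDl divr_gt0.
have : e <= c; last by rewrite leNgt ce.
apply: ub_le_sup; [exact: supA.2|split].
  by rewrite (le_trans ac (ltW ce)) ge_min lexx.
move=> r /andP[ar]; rewrite le_min => /andP[rb rcd].
have [rc|cr] := leP r c; first by apply: Plec; rewrite ar.
apply: Pd => //; rewrite cr/= (le_lt_trans rcd)// ltrD2l.
by rewrite ltr_pdivrMr// ltr_pMr// ltr1n.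
Qed.

(** A continuous function that is positive at [s] stays so near [s]; only its
    zeros, and only those reached with a nonnegative past, need an argument. *)
Lemma nonneg_propagation a b D :
  {within `[a, b], continuous D} -> 0 <= D a ->
  (forall s, a <= s < b -> D s = 0 -> (forall r, a <= r <= s -> 0 <= D r) ->
     exists2 d, 0 < d & forall r, s < r < s + d -> r <= b -> 0 <= D r) ->
  forall s, a <= s <= b -> 0 <= D s.
Proof.
move=> /within_continuous_distP Dc Da step; apply: real_induction => s sab past.
  have [as_|sa] := ltP a s; last first.
    by have -> : s = a by apply/eqP; rewrite eq_le sa; case/andP: sab.
  rewrite leNgt; apply/negP => Ds; have sI : `[a, b]%classic s
    by rewrite /= in_itv.
  have [|d d0 h] := Dc s sI (- D s); first by rewrite oppr_gt0.
  pose r := Num.max a (s - d / 2).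
  have ar : a <= r by rewrite le_max lexx.
  have rs : r < s by rewrite gt_max as_ ltrBlDr ltrDl divr_gt0.
  have /andP[_ sb] := sab.
  have := h r; rewrite /= in_itv/= ar (le_trans (ltW rs) sb) => /(_ isT).
  have sr : s - r <= d / 2 by rewrite lerBlDr -lerBlDl le_max lexx orbT.
  rewrite ltr0_norm ?subr_lt0// opprB (le_lt_trans sr); last first.
    by rewrite ltr_pdivrMr// ltr_pMr// ltr1n.
  move=> /(_ isT); rewrite ltr_norml => /andP[_].
  by rewrite ltrBlDr addNr ltNge past.
have sI : a <= s <= b by case/andP: sab => -> /ltW ->.
have := past s; rewrite lexx andbT => /(_ (andP sab).1).
rewrite le_eqVlt => /predU1P[/esym D0|Ds]; first exact: step.
have [|d d0 h] := Dc s _ (D s) Ds; first by rewrite /= in_itv.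
exists d => // r /andP[sr rd] rb.
have := h r; rewrite /= in_itv/= (le_trans (andP sI).1 (ltW sr)) rb => /(_ isT).
rewrite gtr0_norm ?subr_gt0// ltrBlDl rd => /(_ isT).
by rewrite ltr_norml => /andP[]; rewrite ltrBrDr addNr => /ltW.
Qed.

End RealInduction.

(** * Comparison functions *)

Section ComparisonFunctions.
Variable R : realType.
Implicit Types (alpha g : R -> R) (s t : R).

Lemma classK_lt alpha s t : classK alpha -> 0 <= s -> s < t ->
  alpha s < alpha t.
Proof.
move=> [_ + _] s0 st; apply => //; rewrite in_itv/= andbT//.
exact: le_trans (ltW st).
Qed.

Lemma classK_le alpha s t : classK alpha -> 0 <= s -> s <= t ->
  alpha s <= alpha t.
Proof.
move=> aK s0; rewrite le_eqVlt => /predU1P[->//|st].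
by rewrite ltW// classK_lt.
Qed.

Lemma classK_ge0 alpha s : classK alpha -> 0 <= s -> 0 <= alpha s.
Proof. by move=> aK s0; have [_ _ <-] := aK; exact: classK_le. Qed.

Lemma classK_gt0 alpha s : classK alpha -> 0 < s -> 0 < alpha s.
Proof. by move=> aK s0; have [_ _ <-] := aK; exact: classK_lt. Qed.

Lemma classK_lt_reflect alpha s t : classK alpha -> 0 <= t ->
  alpha s < alpha t -> s < t.
Proof.
by move=> aK t0; apply: contraTT; rewrite -!leNgt => ts; exact: classK_le.
Qed.

Lemma classK_le_reflect alpha s t : classK alpha -> 0 <= t ->
  alpha s <= alpha t -> s <= t.
Proof.
by move=> aK t0; apply: contraTT; rewrite -!ltNge => ts; exact: classK_lt.
Qed.

Lemma classK_comp_continuous alpha (A : set R) g : classK alpha ->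
  (forall t, A t -> 0 <= g t) -> {within A, continuous g} ->
  {within A, continuous (fun t => alpha (g t))}.
Proof.
move=> [ac _ _] g0 /within_continuous_distP gc.
apply/within_continuous_distP => t At e e0.
move/within_continuous_distP : ac => /(_ (g t) _ e e0)[|d d0 ac].
  by rewrite /= in_itv/= andbT g0.
have [d' d'0 {}gc] := gc t At d d0; exists d' => // s As st.
by apply: ac; [rewrite /= in_itv/= andbT g0|exact: gc].
Qed.

Lemma classK_small alpha e : classK alpha -> 0 < e ->
  exists2 d, 0 < d & forall s, 0 <= s -> s < d -> alpha s < e.
Proof.
move=> [/within_continuous_distP ac _ a0] e0.
have [|d d0 h] := ac 0 _ e e0; first by rewrite /= in_itv/= lexx.
exists d => // s s0 sd; have := h s; rewrite /= in_itv/= s0 a0 !subr0.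
by rewrite ger0_norm// => /(_ isT sd); exact: le_lt_trans (ler_norm _).
Qed.

Lemma classKinf_bounded alpha K : classKinf alpha ->
  exists2 r, 0 < r & forall s, 0 <= s -> alpha s <= K -> s <= r.
Proof.
move=> [aK /cvgryPgt/(_ K)[r [_ h]]]; exists (Num.max r 0 + 1).
  by rewrite ltr_wpDl// le_max lexx orbT.
move=> s s0; apply: contraTT; rewrite -!ltNge => rs; apply: h.
by apply: le_lt_trans rs; rewrite ler_wpDr// le_max lexx.
Qed.

End ComparisonFunctions.

(** * Histories and their norm *)

Section Segments.
Variables (R : realType) (n : nat) (tau : R).
Implicit Types (x y phi : R -> 'rV[R]_n) (s t : R).

Lemma histE x t s : - tau <= s <= 0 -> hist tau x t s = x (t + s).
Proof. by move=> h; rewrite /hist patchT// inE/= in_itv/=. Qed.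

Lemma eq_hist x y t : (forall s, t - tau <= s <= t -> x s = y s) ->
  hist tau x t = hist tau y t.
Proof.
move=> xy; apply/funext => s; rewrite /hist /patch; case: ifPn => //.
rewrite inE/= in_itv/= => /andP[s1 s2]; apply: xy.
by rewrite lerD2l s1/= gerDl.
Qed.

Lemma hist_Cseg x t : {within `[t - tau, t], continuous x} ->
  Cseg tau (hist tau x t).
Proof.
move=> /within_continuous_enormP xc; split; last first.
  by move=> s st; rewrite /hist patchN// notin_setE/=; apply/negP.
apply/within_continuous_enormP => s; rewrite /= in_itv/= => sI e e0.
have shift r : - tau <= r <= 0 -> `[t - tau, t]%classic (t + r).
  by move=> /andP[r1 r2]; rewrite /= in_itv/= lerD2l r1 gerDl.
have [d d0 h] := xc (t + s) (shift s sI) e e0; exists d => // r.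
rewrite /= in_itv/= => rI rs; rewrite !histE//; apply: h; first exact: shift.
by rewrite opprD addrACA subrr add0r.
Qed.

Lemma hist_id phi : Cseg tau phi -> hist tau phi 0 = phi.
Proof.
move=> [_ phi0]; apply/funext => s; rewrite /hist /patch; case: ifPn => [_|].
  by rewrite add0r.
by rewrite notin_setE => /negP/phi0 ->.
Qed.

Lemma tnorm_le phi r : 0 <= tau ->
  (forall s, - tau <= s <= 0 -> enorm (phi s) <= r) -> tnorm tau phi <= r.
Proof.
move=> tau0 h; apply: ge_sup.
  by exists (enorm (phi 0)), 0 => //;
    rewrite /= in_itv/= lexx andbT lerNl oppr0.
by move=> _ [s /= + <-]; rewrite in_itv/=; exact: h.
Qed.

Lemma enorm_le_tnorm phi s : Cseg tau phi -> - tau <= s <= 0 ->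
  enorm (phi s) <= tnorm tau phi.
Proof.
move=> [phic _] sI.
have [|c _ h] := @EVT_max _ (fun s => enorm (phi s)) (- tau) 0 _
  (within_continuous_enorm phic).
  by case/andP: sI; exact: le_trans.
apply: ub_le_sup; last by exists s.
exists (enorm (phi c)) => _ [r /= rI <-].
exact: h.
Qed.

Lemma tnorm_ge0 phi : 0 <= tau -> Cseg tau phi -> 0 <= tnorm tau phi.
Proof.
move=> tau0 phiC; apply: le_trans (enorm_ge0 (phi 0)) (enorm_le_tnorm phiC _).
by rewrite lexx oppr_le0 tau0.
Qed.

Lemma enorm_le_tnorm_hist x t s : {within `[t - tau, t], continuous x} ->
  t - tau <= s <= t -> enorm (x s) <= tnorm tau (hist tau x t).
Proof.
move=> xc /andP[s1 s2]; have sI : - tau <= s - t <= 0.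
  by rewrite lerBrDl s1 subr_le0.
have := enorm_le_tnorm (hist_Cseg xc) sI.
by rewrite histE// addrC subrK.
Qed.

Lemma tnorm_hist_le x t r : 0 <= tau ->
  (forall s, t - tau <= s <= t -> enorm (x s) <= r) ->
  tnorm tau (hist tau x t) <= r.
Proof.
move=> tau0 h; apply: tnorm_le => // s sI; rewrite histE//; apply: h.
by case/andP: sI => s1 s2; rewrite lerD2l s1 gerDl.
Qed.

End Segments.

(** * Right derivatives and Dini derivatives *)

Section RightDerivatives.
Variables (R : realType) (n : nat).
Implicit Types (x : R -> 'rV[R]_n) (s t M : R).

Lemma rderiv_growth x t v M : has_rderiv x t v -> enorm v < M ->
  exists2 d, 0 < d & forall s, t < s < t + d -> enorm (x s - x t) <= M * (s -
    t).
Proof.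
move=> xv vM.
have : enorm (0 - h^-1 *: (x (t + h) - x t)) @[h --> 0^'+] --> enorm (0 - v).
  exact: cvg_comp xv (@enorm_dist_continuous _ _ 0 v).
rewrite sub0r enormN => /cvgr_lt/(_ _ vM)[d /= d0 h]; exists d =>
  // s /andP[ts sd].
have st0 : 0 < s - t by rewrite subr_gt0.
have := h (s - t); rewrite /= sub0r normrN gtr0_norm// ltrBlDl => /(_ sd st0).
rewrite sub0r enormN enormZ gtr0_norm ?invr_gt0// subrKC.
by rewrite mulrC ltr_pdivrMr// => /ltW.
Qed.

(** Mean value inequality for right derivatives: with the slope increased to
    [M + eta], the bound extends to the right of every point where it holds. *)
Lemma rderiv_bounded x (a b M : R) : a <= b -> {within `[a, b], continuous x} ->
  (forall t, a <= t < b -> exists2 v, has_rderiv x t v & enorm v <= M) ->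
  enorm (x b - x a) <= M * (b - a).
Proof.
rewrite le_eqVlt => /predU1P[->|ab] xc xd; first by rewrite !subrr enorm0 mulr0.
apply/ler_addgt0Pr => e e0.
have ba0 : 0 < b - a by rewrite subr_gt0.
pose eta := e / (b - a); have eta0 : 0 < eta by rewrite divr_gt0.
have -> : M * (b - a) + e = (M + eta) * (b - a).
  by rewrite mulrDl divfK// gt_eqF.
pose D s := (M + eta) * (s - a) - enorm (x a - x s).
suff : 0 <= D b by rewrite /D subr_ge0 enorm_distC.
apply: (@nonneg_propagation _ a b); last by rewrite lexx ltW.
- apply: within_continuousB; last exact: within_continuous_enorm_dist.
  by apply: continuous_subspaceT; exact: affine_continuous.
- by rewrite /D !subrr enorm0 mulr0 subrr.
move=> s sab _ past; have [v xv vM] := xd s sab.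
have [|d d0 h] := @rderiv_growth x s v (M + eta) xv.
  by rewrite (le_lt_trans vM)// ltrDl.
exists d => // r /[dup] srd /andP[sr _] _.
have := past s; rewrite lexx andbT (andP sab).1 => /(_ isT);
  rewrite /D !subr_ge0 => Ds.
have -> : x a - x r = (x a - x s) + (x s - x r) by rewrite addrA subrK.
have -> : (M + eta) * (r - a) = (M + eta) * (s - a) + (M + eta) * (r - s).
  by ring.
by rewrite (le_trans (enormD _ _))// lerD// enorm_distC h.
Qed.

Lemma upper_dini_growth (tau : R) (V : R -> (R -> 'rV[R]_n) -> R) x t l c :
  (upper_dini tau V x t <= l%:E)%E -> l < c ->
  exists2 d, 0 < d & forall s, t < s < t + d ->
    V s (hist tau x s) <= V t (hist tau x t) + c * (s - t).
Proof.
move=> Vl lc; have : (upper_dini tau V x t < c%:E)%E.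
  by apply: le_lt_trans Vl _; rewrite lte_fin.
move=> /ereal_inf_lt[_ [A [d /= d0 dA] <-]] supc; exists d => // s /andP[ts sd].
have st0 : 0 < s - t by rewrite subr_gt0.
rewrite -lerBlDl -ler_pdivrMr// -lee_fin; apply: le_trans (ltW supc).
apply: ereal_sup_ubound; exists (s - t); last by rewrite subrKC.
by apply: dA => //=; rewrite sub0r normrN gtr0_norm// ltrBlDl.
Qed.

(** A Lipschitz curve on [a, T[ is Cauchy at T. *)
Lemma lipschitz_left_limit x (a T M : R) : a < T ->
  (forall s t, a <= s -> s <= t -> t < T -> enorm (x t - x s) <= M * (t - s)) ->
  exists l, forall s, a <= s -> s < T -> enorm (l - x s) <= M * (T - s).
Proof.
move=> aT xM.
have M0 : 0 <= M.
  have aT2 : a < (a + T) / 2 by rewrite midf_lt.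
  have := xM a ((a + T) / 2) (lexx a) (ltW aT2) (midf_lt aT).2.
  by move=> /(le_trans (enorm_ge0 _)); rewrite pmulr_lge0 ?subr_gt0.
have nearT s : s < T -> \forall t \near T^'-, s <= t < T.
  move=> sT; near=> t; apply/andP; split=> //.
  by near: t; exact: nbhs_left_ge.
have : cauchy (x t @[t --> T^'-]).
  apply: cauchy_exP => e e0.
  pose d := e / (M + 1); have d0 : 0 < d by rewrite divr_gt0// ltr_wpDl.
  pose s := Num.max a (T - d).
  have as_ : a <= s by rewrite le_max lexx.
  have sT : s < T by rewrite gt_max aT ltrBlDr ltrDl.
  exists (x s); suff : \forall t \near T^'-, ball (x s) e (x t) by [].
  near=> t; rewrite -ball_normE/= distrC.
  have /andP[st tT] : s <= t < T by near: t; exact: nearT.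
  apply: le_lt_trans (mx_norm_le_enorm _) _;
    apply: le_lt_trans (xM _ _ as_ st tT) _.
  have tsd : t - s <= d.
    by rewrite lerBlDl (le_trans (ltW tT))// -lerBlDr le_max lexx orbT.
  apply: le_lt_trans (ler_wpM2l M0 tsd) _.
  by rewrite /d mulrCA gtr_pMr// ltr_pdivrMr ?ltr_wpDl// mul1r ltrDl.
move=> /cauchy_cvg/cvg_ex[l xl]; exists l => s as_ sT.
rewrite enorm_distC leNgt; apply/negP => far.
have : enorm (x s - x t) @[t --> T^'-] --> enorm (x s - l).
  exact: cvg_comp xl (@enorm_dist_continuous _ _ (x s) l).
move=> /cvgr_gt/(_ _ far) far_near.
suff : \forall t \near T^'-, False by move=> /filter_ex[].
near=> t; have /andP[st tT] : s <= t < T by near: t; exact: nearT.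
have : M * (T - s) < enorm (x s - x t) by near: t.
move=> /lt_le_trans; rewrite enorm_distC => /(_ _ (xM s t as_ st tT)).
by rewrite ltNge ler_wpM2l// lerD2r ltW.
Unshelve. all: by end_near. Qed.

End RightDerivatives.

(** * Event times *)

Section EventTimes.
Variables (R : realType) (n : nat) (tr : R -> 'rV[R]_n -> 'rV[R]_n -> Prop).
Variable t0 : R.
Implicit Types (x y : R -> 'rV[R]_n) (t : R) (T c : \bar R) (i j : nat).
Local Notation ev := (event_time tr t0).

(** The times over which the infimum defining event number [i.+1] is taken. *)
Definition triggered T x i t :=
  [/\ (ev T x i <= t%:E)%E, (t%:E < T)%E &
      tr t (sampling_error (x (fine (ev T x i))) x t) (x t)].

Lemma event_timeS_le T x i t : triggered T x i t -> (ev T x i.+1 <= t%:E)%E.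
Proof. by move=> h; apply: ereal_inf_lbound; exists t. Qed.

Lemma event_timeS_ge T x i c :
  (forall t, triggered T x i t -> (c <= t%:E)%E) -> (c <= ev T x i.+1)%E.
Proof. by move=> h; apply: le_ereal_inf_tmp => _ [t ht <-]; exact: h. Qed.

Lemma event_timeS_lt T x i c : (ev T x i.+1 < c)%E ->
  exists2 t, triggered T x i t & (t%:E < c)%E.
Proof. by move=> /ereal_inf_lt[_ [t ht <-] tc]; exists t. Qed.

Lemma event_time_leS T x i : (ev T x i <= ev T x i.+1)%E.
Proof. by apply: event_timeS_ge => t []. Qed.

Lemma event_time_le T x i j : (i <= j)%N -> (ev T x i <= ev T x j)%E.
Proof. by apply: (homo_leq (@lexx _ _) le_trans) => k;
  exact: event_time_leS. Qed.

Lemma event_time_ge_start T x i : (t0%:E <= ev T x i)%E.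
Proof. exact: (@event_time_le T x 0 i). Qed.

Lemma event_time_fineK T x i t : (ev T x i <= t%:E)%E ->
  (fine (ev T x i))%:E = ev T x i.
Proof.
move=> h; apply: fineK; rewrite fin_numElt.
rewrite (lt_le_trans _ (event_time_ge_start T x i)) ?ltNyr//.
by rewrite (le_lt_trans h)// ltry.
Qed.

Lemma fine_event_time T x i t : (ev T x i <= t%:E)%E ->
  t0 <= fine (ev T x i) <= t.
Proof.
move=> h; rewrite -!lee_fin (event_time_fineK h) h andbT.
exact: event_time_ge_start.
Qed.

Lemma event_time_no_trigger T x i t : (ev T x i <= t%:E < ev T x i.+1)%E ->
  (t%:E < T)%E ->
  ~ tr t (sampling_error (x (fine (ev T x i))) x t) (x t).
Proof.
move=> /andP[ti tSi] tT trt; move: tSi; rewrite ltNge => /negP; apply.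
exact: event_timeS_le.
Qed.

Lemma event_index_unique T x i j t :
  (ev T x i <= t%:E < ev T x i.+1)%E -> (ev T x j <= t%:E < ev T x j.+1)%E ->
  i = j.
Proof.
wlog ij : i j / (i < j)%N.
  move=> h; have [ij|ji|//] := ltngtP i j; first exact: h.
  by move=> hi hj; apply/esym; exact: h.
move=> /andP[_ tSi] /andP[jt _]; have := le_lt_trans jt tSi.
by rewrite ltNge event_time_le.
Qed.

(** Event times are defined by looking forward only up to their own value, so
    those before [c] depend only on the trajectory before [c]. *)
Lemma event_time_local T1 T2 x1 x2 c i : (c <= T1)%E -> (c <= T2)%E ->
  (forall t, t0 <= t -> (t%:E < c)%E -> x1 t = x2 t) ->
  (ev T1 x1 i < c)%E -> ev T2 x2 i = ev T1 x1 i.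
Proof.
move=> cT1 cT2 x12; elim: i => [//|i IHi] evc.
have evic := le_lt_trans (event_time_leS T1 x1 i) evc.
have {}IHi := IHi evic.
have [s trs sc] := event_timeS_lt evc.
have ti : x1 (fine (ev T1 x1 i)) = x2 (fine (ev T1 x1 i)).
  have [si _ _] := trs; have /andP[h _] := fine_event_time si.
  by apply: x12 => //; rewrite (event_time_fineK si).
have same t : (t%:E < c)%E -> triggered T1 x1 i t <-> triggered T2 x2 i t.
  move=> tc; rewrite /triggered IHi /sampling_error ti.
  have xt : (ev T1 x1 i <= t%:E)%E -> x1 t = x2 t.
    by move=> it; apply: x12 => //; case/andP: (fine_event_time it);
      exact: le_trans.
  split=> -[it _]; rewrite xt//; split => //.
    exact: lt_le_trans tc cT2.
  exact: lt_le_trans tc cT1.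
apply/eqP; rewrite eq_le; apply/andP; split; apply: event_timeS_ge => t trt.
  have [tc|ct] := ltP t%:E c; first by apply: event_timeS_le; exact/same.
  apply: le_trans (le_trans (ltW sc) ct); apply: event_timeS_le.
  exact/same.
have [tc|ct] := ltP t%:E c; first by apply: event_timeS_le; exact/same.
exact: le_trans (ltW evc) ct.
Qed.

End EventTimes.

(** * Solutions of the closed loop *)

Section ClosedLoop.
Variables (R : realType) (n m : nat) (tau : R).
Variables (f : R -> (R -> 'rV[R]_n) -> 'rV[R]_m -> 'rV[R]_n).
Variables (k : 'rV[R]_n -> 'rV[R]_m) (tr : R -> 'rV[R]_n -> 'rV[R]_n -> Prop).
Variable t0 : R.
Hypothesis tau_ge0 : 0 <= tau.
Implicit Types (x y : R -> 'rV[R]_n) (t : R) (T c : \bar R) (i j : nat).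
Local Notation ev := (event_time tr t0).

(** The last clause of [solution] at a single time, isolated because it is what
    has to be carried over between trajectories that agree for a while. *)
Definition driven T x t := exists i, let ti := ev T x i in
  (ti <= t%:E < ev T x i.+1)%E /\ closed_loop_eq tau f k (x (fine ti)) x t.

Lemma closed_loop_eqE xi x t :
  closed_loop_eq tau f k xi x t = has_rderiv x t (f t (hist tau x t) (k xi)).
Proof. by rewrite /closed_loop_eq /sampling_error subrKC. Qed.

Lemma closed_loop_eq_local xi x1 x2 t c : (t%:E < c)%E ->
  (forall s, t - tau <= s -> (s%:E < c)%E -> x1 s = x2 s) ->
  closed_loop_eq tau f k xi x1 t -> closed_loop_eq tau f k xi x2 t.
Proof.
move=> tc x12; rewrite !closed_loop_eqE.
have -> : hist tau x1 t = hist tau x2 t.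
  by apply: eq_hist => s /andP[s1 s2]; apply: x12 => //; exact: le_lt_trans tc.
apply: cvg_trans; apply: near_eq_cvg.
have [d d0 tdc] : exists2 d, 0 < d & ((t + d)%:E <= c)%E.
  case: c tc {x12} => [r| |//]; last by exists 1; rewrite ?leey.
  by rewrite lte_fin => tr0; exists (r - t); rewrite ?subr_gt0// subrKC.
have before_c h : 0 <= h -> h < d -> x1 (t + h) = x2 (t + h).
  move=> h0 hd; apply: x12; first by rewrite lerD2l (le_trans _ h0)// oppr_le0.
  by rewrite (lt_le_trans _ tdc)// lte_fin ltrD2l.
have xt : x1 t = x2 t by have := before_c 0; rewrite addr0; apply.
by near=> h; rewrite xt before_c.
Unshelve. all: by end_near. Qed.

Lemma driven_local T1 T2 x1 x2 c t : t0 <= t -> (t%:E < c)%E ->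
  (c <= T1)%E -> (c <= T2)%E ->
  (forall s, t0 - tau <= s -> (s%:E < c)%E -> x1 s = x2 s) ->
  driven T1 x1 t -> driven T2 x2 t.
Proof.
move=> t0t tc cT1 cT2 x12 [i [/andP[it tSi] xt]].
have x12' s : t0 <= s -> (s%:E < c)%E -> x1 s = x2 s.
  by move=> s0; apply: x12; rewrite (le_trans _ s0)// gerBl.
have x21' s : t0 <= s -> (s%:E < c)%E -> x2 s = x1 s by move=> *; rewrite x12'.
have evi : ev T2 x2 i = ev T1 x1 i.
  exact: event_time_local cT1 cT2 x12' (le_lt_trans it tc).
exists i; split.
  rewrite evi it andTb; have [evc|] := ltP (ev T2 x2 i.+1) c;
    last exact: lt_le_trans.
  by rewrite -(event_time_local cT2 cT1 x21' evc).
rewrite evi; have /andP[h1 h2] := fine_event_time it.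
rewrite -x12'//; last by rewrite (event_time_fineK it) (le_lt_trans it).
apply: closed_loop_eq_local tc _ xt => s s1; apply: x12.
by apply: le_trans s1; rewrite lerD2r.
Qed.

Section Solution.
Variables (phi : R -> 'rV[R]_n) (T : \bar R) (x : R -> 'rV[R]_n).
Hypothesis sol : solution tau f k tr t0 phi T x.

Lemma solution_continuous a b : t0 - tau <= a -> (b%:E < T)%E ->
  {within `[a, b], continuous x}.
Proof.
move=> a0 bT; have [_ xc _ _] := sol; apply: continuous_subspaceW xc => s /=.
rewrite in_itv/= => /andP[as_ sb]; split; first exact: le_trans as_.
by rewrite (le_lt_trans _ bT)// lee_fin.
Qed.

(** From any time [t] until the next event, the trajectory is a solution with
    the held sample, to which the dissipation inequality applies. *)
Lemma solution_held t : t0 <= t -> (t%:E < T)%E ->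
  exists i, (ev T x i <= t%:E < ev T x i.+1)%E /\
  exists T' : R, held_solution tau f k (x (fine (ev T x i))) t (hist tau x t)
    T' x.
Proof.
move=> t0t tT; have [_ xc _ xd] := sol.
have [i [/[dup] it /andP[ti tSi] xt]] := xd t t0t tT.
exists i; split => //.
have [T' tT' [T'S T'T]] : exists2 T' : R, t < T' &
    (T'%:E <= ev T x i.+1)%E /\ (T'%:E <= T)%E.
  have : (t%:E < Order.min (ev T x i.+1) T)%E by rewrite lt_min tSi.
  case e : (Order.min (ev T x i.+1) T) => [r| |//].
    rewrite lte_fin => tr0; exists r => //.
    by have : (r%:E <= r%:E)%E := lexx _; rewrite -{2}e le_min => /andP.
  move=> _; exists (t + 1); first by rewrite ltrDl.
  have : (+oo <= Order.min (ev T x i.+1) T)%E by rewrite e.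
  by rewrite le_min => /andP[/(le_trans (leey _)) -> /(le_trans (leey _)) ->].
exists T'; split => //.
  apply: continuous_subspaceW xc => s /=; rewrite in_itv/= => /andP[s1 s2].
  split; first by rewrite (le_trans _ s1)// lerD2r.
  by rewrite (lt_le_trans _ T'T)// lte_fin.
move=> s ts sT'; have [||j [js xs]] := xd s; [exact: le_trans ts| |].
  by rewrite (lt_le_trans _ T'T)// lte_fin.
suff -> : i = j by [].
apply: event_index_unique js; rewrite (le_trans ti) ?lee_fin//=.
by rewrite (lt_le_trans _ T'S)// lte_fin.
Qed.

End Solution.

End ClosedLoop.

(** * The Lyapunov functional along a trajectory *)

Section EventTriggeredLoop.
Variables (R : realType) (n m : nat) (tau : R).
Variables (f : R -> (R -> 'rV[R]_n) -> 'rV[R]_m -> 'rV[R]_n).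
Variables (k : 'rV[R]_n -> 'rV[R]_m).
Variables (V1 : R -> 'rV[R]_n -> R) (V2 : R -> (R -> 'rV[R]_n) -> R).
Variables (alpha1 alpha2 alpha3 chi : R -> R) (mu sigma a b t0 : R).
Hypothesis tau_gt0 : 0 < tau.
Hypothesis f0 : forall t, 0 <= t -> f t (fun=> 0) 0 = 0.
Hypothesis k0 : k 0 = 0.
Hypothesis solvable : locally_solvable tau f k.
Hypothesis V1_V0 : classV0 V1.
Hypothesis V2_V0star : classV0star tau V2.
Hypothesis alpha1_Kinf : classKinf alpha1.
Hypothesis alpha2_K : classK alpha2.
Hypothesis alpha3_K : classK alpha3.
Hypothesis chi_K : classK chi.
Hypothesis V1_bounds : forall t phi, 0 <= t -> Cseg tau phi ->
  alpha1 (enorm (phi 0)) <= V1 t (phi 0) <= alpha2 (enorm (phi 0)).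
Hypothesis V2_bounds : forall t phi, 0 <= t -> Cseg tau phi ->
  0 <= V2 t phi <= alpha3 (tnorm tau phi).
Hypothesis V_dissipation :
  dissipation tau f k (fun t phi => V1 t (phi 0) + V2 t phi) mu chi.
Hypothesis t0_ge0 : 0 <= t0.
Hypothesis sigma_bounds : 0 <= sigma < mu.
Hypothesis a_gt0 : 0 < a.
Hypothesis b_gt0 : 0 < b.
Hypothesis k_lip : locally_lipschitz (@enorm R n) (@enorm R m) setT k.
Hypothesis f_lip_state : lipschitz_in_state tau f.
Hypothesis f_lip_input : lipschitz_in_input tau f.
Implicit Types (x : R -> 'rV[R]_n) (s t : R) (i j : nat).

Local Notation tr := (trigger alpha1 chi sigma a b t0).
Local Notation ev := (event_time tr t0).

Let tau_ge0 : 0 <= tau := ltW tau_gt0.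
Let alpha1_K : classK alpha1 := alpha1_Kinf.1.

Definition threshold t := chi (a * expR (- b * (t - t0))).

Let decay_ge0 t : 0 <= a * expR (- b * (t - t0)).
Proof. by rewrite mulr_ge0 ?expR_ge0// ltW. Qed.

Lemma threshold_gt0 t : 0 < threshold t.
Proof. by rewrite /threshold classK_gt0// mulr_gt0 ?expR_gt0. Qed.

Lemma threshold_le s t : s <= t -> threshold t <= threshold s.
Proof.
move=> st; rewrite /threshold; apply: classK_le => //.
rewrite ler_pM2l// ler_expR.
by rewrite ler_nM2l ?oppr_lt0// lerD2r.
Qed.

Lemma threshold_small e : 0 < e -> exists2 s, t0 <= s & threshold s < e.
Proof.
move=> e0; have [d d0 chi_e] := classK_small chi_K e0.
exists (t0 + a / (b * d)); first by rewrite lerDl divr_ge0 ?mulr_ge0// ltW.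
apply: chi_e => //; rewrite addrAC subrr add0r.
(* exp y >= 1 + y at the exponent a / d *)
have -> : - b * (a / (b * d)) = - (a / d).
  by field; rewrite !gt_eqF.
rewrite expRN ltr_pdivrMr ?expR_gt0// mulrC -ltr_pdivrMr//.
by apply: lt_le_trans (expR_ge1Dx _); rewrite ltrDr.
Qed.

Definition trigger_gap (xi : 'rV[R]_n) x t :=
  chi (enorm (xi - x t)) - (sigma * alpha1 (enorm (x t)) + threshold t).

Lemma triggerP xi x t : tr t (sampling_error xi x t) (x t) <-> trigger_gap xi x
  t = 0.
Proof.
rewrite /trigger /trigger_gap /sampling_error -/(threshold t).
by split=> [->|/eqP]; rewrite ?subrr// subr_eq0 => /eqP.
Qed.

Lemma trigger_gap_sample x t : trigger_gap (x t) x t < 0.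
Proof.
rewrite /trigger_gap subrr enorm0; have [_ _ ->] := chi_K.
rewrite sub0r oppr_lt0 ltr_wpDl ?threshold_gt0//.
apply: mulr_ge0; first by case/andP: sigma_bounds.
by apply: classK_ge0; last exact: enorm_ge0.
Qed.

Lemma trigger_gap_continuous (A : set R) xi x : {within A, continuous x} ->
  {within A, continuous (trigger_gap xi x)}.
Proof.
move=> xc; apply: within_continuousB.
  by apply: classK_comp_continuous => //; [move=> *;
    exact: enorm_ge0|exact: within_continuous_enorm_dist].
have alphac : {within A, continuous (fun t => alpha1 (enorm (x t)))}.
  apply: classK_comp_continuous => //; first by move=> *; exact: enorm_ge0.
  exact: within_continuous_enorm.
have thrc : {within A, continuous threshold}.
  apply: classK_comp_continuous => //; apply: continuous_subspaceT => t.
  apply: cvgM; first exact: cvg_cst.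
  apply: (@continuous_comp _ _ _ (fun t => - b * (t - t0)) expR).
    exact: affine_continuous.
  exact: continuous_expR.
move: alphac thrc; rewrite !subspace_continuousP => alphac thrc t At.
apply: cvgD; last exact: thrc.
by apply: cvgM; [exact: cvg_cst|exact: alphac].
Qed.

(** Balls of the state space are compact, so the local Lipschitz condition is
    enough for the feedback to be bounded on them. *)
Lemma feedback_bounded r : exists2 r', 0 <= r' &
  forall y, enorm y <= r -> enorm (k y) <= r'.
Proof.
have kc : continuous (fun y => enorm (k y)).
  move=> y A /nbhs_ballP[e /= e0 eA].
  have [d d0 [L kL]] : exists2 d, 0 < d & exists L, forall u w, setT u -> setT
    w ->
      enorm (u - y) < d -> enorm (w - y) < d -> enorm (k u - k w) <= L * enorm
        (u - w).
    exact: k_lip.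
  have near_y : \forall z \near y, enorm (y - z) < Num.min d (e / (`|L| + 1)).
    have := @enorm_dist_continuous _ _ y y; rewrite /continuous_at subrr enorm0.
    by move=> /cvgr_lt; apply; rewrite lt_min d0 divr_gt0// ltr_wpDl.
  suff : \forall z \near y, A (enorm (k z)) by [].
  apply: filterS near_y => z; rewrite lt_min => /andP[zd ze]; apply: eA.
  apply: le_lt_trans (enorm_dist _ _) _.
  apply: le_lt_trans (kL y z I I _ _) _; first by rewrite subrr enorm0.
    by rewrite enorm_distC.
  move: ze; rewrite ltr_pdivlMr ?ltr_wpDl// => ze; apply: le_lt_trans ze.
  rewrite mulrC ler_wpM2l ?enorm_ge0// (le_trans (ler_norm _))//.
  by rewrite lerDl.
pose S := [set y : 'rV[R]_n | enorm y <= r].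
have cS : compact S.
  apply: bounded_closed_compact.
    exists r; split; first exact: num_real.
    move=> M rM y yr; apply: le_trans (mx_norm_le_enorm y) _.
    exact: le_trans yr (ltW rM).
  by apply: (closed_comp _ (@closed_le _ r)) => y _; exact: enorm_continuous.
have /compact_bounded[M [_ MS]] : compact [set enorm (k y) | y in S].
  by apply: continuous_compact => //; exact: continuous_subspaceT.
exists (`|M| + 1) => [|y yr]; first by rewrite addr_ge0.
suff : [set z : R | `|z| <= `|M| + 1] (enorm (k y)).
  by rewrite /= ger0_norm ?enorm_ge0.
by apply: MS; [rewrite (le_lt_trans (ler_norm _))// ltrDl|exists y].
Qed.

(** Linear growth, from the Lipschitz bounds and [f t 0 0 = 0]. *)
Lemma vector_field_growth B r : 0 <= r -> exists2 L, 0 <= L &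
  forall t phi u, 0 <= t <= B -> Cseg tau phi -> tnorm tau phi <= r ->
    enorm u <= r -> enorm (f t phi u) <= L * (tnorm tau phi + enorm u).
Proof.
move=> r0; have [L1 f1] := f_lip_state B r; have [L2 f2] := f_lip_input B r.
exists (Num.max 0 (Num.max L1 L2)) => [|t phi u tB phiC phir ur].
  by rewrite le_max lexx.
set L := Num.max _ _.
have L1L : L1 <= L by rewrite !le_max lexx !orbT.
have L2L : L2 <= L by rewrite !le_max lexx !orbT.
have C0 : Cseg tau (fun=> 0 : 'rV[R]_n).
  by split=> //; apply: continuous_subspaceT; exact: cst_continuous.
have t00 : tnorm tau (fun=> 0 : 'rV[R]_n) <= r.
  by apply: tnorm_le => // s _; rewrite enorm0.
have phi_ge0 : 0 <= tnorm tau phi by exact: tnorm_ge0.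
have e00 : enorm (0 : 'rV[R]_m) <= r by rewrite enorm0.
have := f1 t phi (fun=> 0) 0 tB phiC C0 phir t00 e00.
have := f2 t phi u 0 tB phiC phir ur e00.
have t_ge0 : 0 <= t by case/andP: tB.
have -> : phi - (fun=> 0) = phi by apply/funext => s; rewrite /= subr0.
rewrite (f0 t_ge0) !subr0 => f2u f1phi.
rewrite -(subrK (f t phi 0) (f t phi u)) (le_trans (enormD _ _))// addrC mulrDr.
apply: lerD.
  by apply: le_trans f1phi _; rewrite ler_wpM2r.
by apply: le_trans f2u _; rewrite ler_wpM2r ?enorm_ge0.
Qed.

Lemma vector_field_bounded B r : exists2 M, 0 < M &
  forall t phi y, 0 <= t <= B -> Cseg tau phi -> tnorm tau phi <= r ->
    enorm y <= r -> enorm (f t phi (k y)) <= M.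
Proof.
have [r' r'0 kr] := feedback_bounded r.
have rr0 : 0 <= Num.max r r' by rewrite le_max r'0 orbT.
have [L L0 fL] := @vector_field_growth B _ rr0.
exists (L * (Num.max r r' + Num.max r r') + 1).
  by rewrite ltr_wpDl// mulr_ge0// addr_ge0.
move=> t phi y tB phiC phir yr; have ky := kr y yr.
have phir' : tnorm tau phi <= Num.max r r' by rewrite le_max phir.
have kyr' : enorm (k y) <= Num.max r r' by rewrite le_max ky orbT.
apply: le_trans (fL _ _ _ tB phiC phir' kyr') _.
by rewrite ler_wpDr// ler_wpM2l// lerD.
Qed.

Definition lyapunov x t := V1 t (hist tau x t 0) + V2 t (hist tau x t).

Section Trajectory.
Variables (phi : R -> 'rV[R]_n) (T : \bar R) (x : R -> 'rV[R]_n).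
Hypothesis sol : solution tau f k tr t0 phi T x.

Local Notation W := (lyapunov x).

Let zero_in : - tau <= (0 : R) <= 0.
Proof. by rewrite lexx oppr_le0 tau_ge0. Qed.

Lemma solution_hist_Cseg t : t0 <= t -> (t%:E < T)%E -> Cseg tau (hist tau x t).
Proof.
move=> t0t tT; apply: hist_Cseg; apply: (solution_continuous sol) => //.
by rewrite lerD2r.
Qed.

Lemma lyapunov_ge t : t0 <= t -> (t%:E < T)%E -> alpha1 (enorm (x t)) <= W t.
Proof.
move=> t0t tT; have phiC := solution_hist_Cseg t0t tT.
have tge0 := le_trans t0_ge0 t0t.
have /andP[h _] := V1_bounds tge0 phiC; have /andP[h2 _] := V2_bounds tge0 phiC.
move: h; rewrite histE// addr0 => h; rewrite /lyapunov histE// addr0.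
by rewrite -(addr0 (alpha1 _)) lerD.
Qed.

Lemma lyapunov_le t : t0 <= t -> (t%:E < T)%E ->
  W t <= alpha2 (enorm (x t)) + alpha3 (tnorm tau (hist tau x t)).
Proof.
move=> t0t tT; have phiC := solution_hist_Cseg t0t tT.
have tge0 := le_trans t0_ge0 t0t.
have /andP[_ h] := V1_bounds tge0 phiC; have /andP[_ h2] := V2_bounds tge0 phiC.
by move: h; rewrite histE// addr0 => h; rewrite /lyapunov histE// addr0 lerD.
Qed.

(** The classes of [V1] and [V2] speak of curves defined on a half-line, so the
    trajectory is first frozen outside [t0 - tau, d]. *)
Lemma lyapunov_continuous c d : t0 <= c -> (d%:E < T)%E -> {within `[c, d],
  continuous W}.
Proof.
move=> t0c dT; have [_ V1c] := V1_V0; have [_ V2c _] := V2_V0star.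
have [cd|dc] := leP c d; last first.
  apply/within_continuous_distP => t; rewrite /= in_itv/= => /andP[ct td].
  by move: (le_trans ct td); rewrite leNgt dc.
pose clip s := Num.max (t0 - tau) (Num.min s d).
have clip_id s : t0 - tau <= s -> s <= d -> clip s = s.
  by move=> s1 s2; rewrite /clip (min_idPl s2) (max_idPr s1).
have t0d : t0 - tau <= d by rewrite (le_trans _ cd)// (le_trans _ t0c)// gerBl.
have clipI s : t0 - tau <= clip s <= d.
  by rewrite le_max lexx/= ge_max t0d ge_min lexx orbT.
have clip_dist s t : `|clip s - clip t| <= `|s - t|.
  have mono u v : u <= v -> 0 <= clip v - clip u <= v - u.
    move=> uv; rewrite /clip; case: (leP u d) => ud; case: (leP v d) => vd;
      rewrite ?maxEle; do ?case: ifPn; rewrite -?ltNge => *; lra.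
  have [st|ts] := leP s t.
    have /andP[h1 h2] := mono s t st.
    by rewrite distrC ger0_norm// distrC ger0_norm ?subr_ge0.
  have /andP[h1 h2] := mono t s (ltW ts).
  by rewrite ger0_norm// ger0_norm ?subr_ge0// ltW.
pose y s := x (clip s).
have yc (A : set R) : {within A, continuous y}.
  have /within_continuous_enormP xc :=
    solution_continuous sol (lexx (t0 - tau)) dT.
  apply/within_continuous_enormP => t _ e e0.
  have [|r r0 h] := xc (clip t) _ e e0; first by rewrite /= in_itv/= clipI.
  exists r => // s _ sr; apply: h; first by rewrite /= in_itv/= clipI.
  exact: le_lt_trans (clip_dist _ _) sr.
have Wc : {within `[0, +oo[%classic, continuous
    (fun t => V1 t (y t) + V2 t (hist tau y t))}.
  move: (V1c y (yc _)) (V2c y (yc _)).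
  rewrite !subspace_continuousP => V1y V2y t At.
  by apply: cvgD; [exact: V1y|exact: V2y].
have WE t : c <= t <= d -> W t = V1 t (y t) + V2 t (hist tau y t).
  move=> /andP[ct td]; have t0t : t0 - tau <= t - tau.
    by rewrite lerD2r (le_trans t0c).
  rewrite /lyapunov histE// addr0 /y clip_id ?(le_trans t0t) ?gerBl//.
  congr (_ + V2 t _); apply: eq_hist => s /andP[ts st].
  by rewrite clip_id// ?(le_trans t0t)// (le_trans st).
move/within_continuous_distP : Wc => Wc; apply/within_continuous_distP.
move=> t; rewrite /= in_itv/= => tI e e0.
have pos s : c <= s -> 0 <= s by apply: le_trans; exact: le_trans t0c.
have [|r r0 h] := Wc t _ e e0; first by rewrite /= in_itv/= andbT pos//;
  case/andP: tI.
exists r => // s; rewrite in_itv/= => sI sr; rewrite !WE//; apply: h => //.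
by rewrite /= in_itv/= andbT pos//; case/andP: sI.
Qed.

(** The gap is negative at the sampling time, where the error vanishes, and by the
    intermediate value theorem it cannot change sign before the next event. *)
Lemma error_le i t : (ev T x i <= t%:E < ev T x i.+1)%E -> (t%:E < T)%E ->
  chi (enorm (sampling_error (x (fine (ev T x i))) x t)) <=
  sigma * alpha1 (enorm (x t)) + threshold t.
Proof.
move=> /andP[it tSi] tT; rewrite -subr_le0 leNgt; apply/negP => pos.
have /andP[h1 h2] := fine_event_time it.
set ti := fine _ in h1 h2 pos.
have gapc : {within `[ti, t], continuous (trigger_gap (x ti) x)}.
  apply: trigger_gap_continuous; apply: (solution_continuous sol) => //.
  by rewrite (le_trans _ h1)// gerBl.
have := @IVT _ (trigger_gap (x ti) x) ti t 0 h2 gapc.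
have neg := trigger_gap_sample x ti.
case=> [|s]; first by rewrite ge_min (ltW neg)/= le_max (ltW pos) orbT.
rewrite in_itv/= => /andP[tis st] /triggerP.
apply: event_time_no_trigger; last by rewrite (le_lt_trans _ tT)// lee_fin.
by rewrite -(event_time_fineK it) lee_fin tis (le_lt_trans _ tSi)// lee_fin.
Qed.

(** The error term costs at most [sigma * W t + threshold t], because
    [alpha1 (enorm (x t)) <= W t]. *)
Lemma lyapunov_growth t c : t0 <= t -> (t%:E < T)%E ->
  - (mu - sigma) * W t + threshold t < c ->
  exists2 d, 0 < d & forall s, t < s < t + d -> W s <= W t + c * (s - t).
Proof.
move=> t0t tT ltc; have [i [it [T' held]]] := solution_held sol t0t tT.
have phiC := solution_hist_Cseg t0t tT.
have := V_dissipation (le_trans t0_ge0 t0t) phiC held.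
move=> /upper_dini_growth; apply; apply: le_lt_trans ltc.
have := error_le it tT; rewrite -/(lyapunov x t) => err.
have := lyapunov_ge t0t tT; set al := alpha1 _ in err * => alW.
have : sigma * al <= sigma * W t by rewrite ler_wpM2l//;
  case/andP: sigma_bounds.
by lra.
Qed.

(** Where [W] meets the barrier [p], the dissipation inequality makes [W] decrease
    faster than [p], which is therefore never crossed. *)
Lemma lyapunov_barrier p s0 s1 : t0 <= s0 -> (s1%:E < T)%E ->
  {within `[s0, s1], continuous p} -> W s0 <= p s0 ->
  (forall t, s0 <= t < s1 -> W t = p t ->
     exists2 c, - (mu - sigma) * p t + threshold t < c &
     forall s, t <= s -> p t + c * (s - t) <= p s) ->
  forall t, s0 <= t <= s1 -> W t <= p t.
Proof.
move=> t0s0 s1T pc Wp0 slope t tI; rewrite -subr_ge0.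
apply: (@nonneg_propagation _ s0 s1 (fun t => p t - W t)) tI.
- by apply: within_continuousB => //; exact: lyapunov_continuous.
- by rewrite subr_ge0.
move=> {}t tI /eqP; rewrite subr_eq0 => /eqP/esym Wp _.
have [c pW pgrow] := slope t tI Wp.
have t0t : t0 <= t by case/andP: tI => + _; exact: le_trans.
have tT : (t%:E < T)%E.
  by apply: le_lt_trans s1T; rewrite lee_fin; case/andP: tI => _ /ltW.
have [|d d0 Wgrow] := @lyapunov_growth t c t0t tT; first by rewrite Wp.
exists d => // s /[dup] ts /andP[/ltW lets _] _; rewrite subr_ge0.
by apply: le_trans (Wgrow s ts) _; rewrite Wp; exact: pgrow.
Qed.

Lemma lyapunov_invariant s0 K : t0 <= s0 -> (s0%:E < T)%E -> W s0 <= K ->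
  threshold s0 < (mu - sigma) * K ->
  forall t, s0 <= t -> (t%:E < T)%E -> W t <= K.
Proof.
move=> t0s0 s0T WK thrK t s0t tT.
apply: (@lyapunov_barrier (fun=> K) s0 t) => //; last by rewrite s0t lexx.
  by apply: continuous_subspaceT => ?; exact: cst_continuous.
move=> s /andP[s0s _] _; exists 0 => [|r _]; last by rewrite mul0r addr0.
by have := threshold_le s0s; lra.
Qed.

(** * Boundedness and absence of Zeno behavior *)

Lemma lyapunov_bounded :
  exists K, forall t, t0 <= t -> (t%:E < T)%E -> W t <= K.
Proof.
have [t0T _ _ _] := sol; have /andP[_ sm] := sigma_bounds.
have lam0 : 0 < mu - sigma by rewrite subr_gt0.
exists (Num.max (W t0) (threshold t0 / (mu - sigma) + 1)).
apply: lyapunov_invariant; [exact: lexx|exact: t0T|by rewrite le_max lexx|].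
rewrite mulrC -ltr_pdivrMr//; apply: (@lt_le_trans _ _ (threshold t0 / (mu -
  sigma) + 1)).
  by rewrite ltrDl.
by rewrite le_max lexx orbT.
Qed.

Lemma trajectory_bounded :
  exists r, forall t, t0 - tau <= t -> (t%:E < T)%E -> enorm (x t) <= r.
Proof.
have [K WK] := lyapunov_bounded; have [t0T _ _ _] := sol.
have [r _ alpha1r] := classKinf_bounded K alpha1_Kinf.
exists (Num.max r (tnorm tau (hist tau x t0))) => t t1 tT; rewrite le_max.
have [t0t|tt0] := leP t0 t.
  rewrite alpha1r ?enorm_ge0//.
  exact: le_trans (lyapunov_ge t0t tT) (WK t t0t tT).
apply/orP; right; apply: enorm_le_tnorm_hist; last by rewrite t1 ltW.
exact: (solution_continuous sol).
Qed.

Lemma trajectory_lipschitz B : exists2 M, 0 < M &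
  forall s t, t0 <= s -> s <= t -> (t%:E < T)%E -> t <= B ->
    enorm (x t - x s) <= M * (t - s).
Proof.
have [r xr] := trajectory_bounded; have [_ _ _ xd] := sol.
have [M M0 fM] := vector_field_bounded B r; exists M => // s t t0s st tT tB.
apply: rderiv_bounded => //.
  by apply: (solution_continuous sol) => //; rewrite (le_trans _ t0s)// gerBl.
move=> u /andP[su ut]; have t0u := le_trans t0s su.
have uT : (u%:E < T)%E by rewrite (lt_trans _ tT)// lte_fin.
have [i [/andP[iu _] +]] := xd u t0u uT; rewrite closed_loop_eqE => xu.
have /andP[h1 h2] := fine_event_time iu.
eexists; first exact: xu.
apply: fM; [|exact: solution_hist_Cseg| |].
- by rewrite (le_trans t0_ge0)//= (le_trans (ltW ut)).
- apply: tnorm_hist_le => // v /andP[v1 v2]; apply: xr.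
    by apply: le_trans v1; rewrite lerD2r.
  by rewrite (le_lt_trans _ uT)// lee_fin.
- apply: xr; first by rewrite (le_trans _ h1)// gerBl.
  by rewrite (le_lt_trans _ uT)// lee_fin.
Qed.

(** Between two events the error has to grow from 0 to at least
    [a * expR (- b * (t - t0))], at a speed bounded by the Lipschitz constant of the
    trajectory; on a bounded time interval this takes a minimal time. *)
Lemma event_gap B : exists2 d, 0 < d &
  forall i, (ev T x i.+1 <= B%:E)%E -> (ev T x i + d%:E <= ev T x i.+1)%E.
Proof.
have [M M0 xM] := trajectory_lipschitz (B + 1).
pose eta := a * expR (- b * (B + 1 - t0)).
have eta0 : 0 < eta by rewrite mulr_gt0// expR_gt0.
exists (Num.min (eta / M) 1); first by rewrite lt_min divr_gt0/=.
move=> i iB; apply: event_timeS_ge => t [it tT trt].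
have /andP[h1 h2] := fine_event_time it.
have iB' : (ev T x i <= B%:E)%E := le_trans (event_time_leS _ _ _ _ _) iB.
move: iB' trt; rewrite -(event_time_fineK it) -EFinD !lee_fin.
set ti := fine _ in h1 h2 * => tiB trt.
(* a time beyond B + 1 is far from event number i, which is at most B *)
have [tB|Bt] := leP t (B + 1); last first.
  by rewrite (le_trans _ (ltW Bt))// lerD// ge_min lexx orbT.
rewrite -lerBrDl ge_min; apply/orP; left.
rewrite ler_pdivrMr// mulrC; apply: le_trans (xM ti t h1 h2 tT tB).
apply: (classK_le_reflect chi_K (enorm_ge0 _)).
rewrite enorm_distC trt; apply: le_trans (threshold_le tB) _.
rewrite lerDr mulr_ge0//; first by case/andP: sigma_bounds.
by apply: classK_ge0 => //; exact: enorm_ge0.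
Qed.

Lemma finitely_many_events B : exists N : nat,
  forall i, (ev T x i <= B%:E)%E -> (i < N)%N.
Proof.
have [d d0 gap] := event_gap B.
exists (Num.bound `|(B - t0) / d|) => i iB.
have : ((t0 + i%:R * d)%:E <= ev T x i)%E.
  elim: i iB => [_|i IHi iB]; first by rewrite mul0r addr0.
  apply: le_trans (gap i iB); rewrite -natr1 mulrDl mul1r addrA EFinD.
  by rewrite leeD2r// IHi// (le_trans (event_time_leS _ _ _ _ _) iB).
move=> /le_trans/(_ iB); rewrite lee_fin -lerBrDl -ler_pdivlMr// => h.
rewrite -(ltr_nat R); apply: le_lt_trans h _.
by apply: le_lt_trans (ler_norm _) _; exact: archi_boundP.
Qed.

Lemma not_zeno : ~ zeno tr t0 T x.
Proof.
move=> [B inf]; have [N few] := finitely_many_events B; apply: inf.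
by apply: sub_finite_set (finite_II N) => i /few.
Qed.

End Trajectory.

(** * Stability and attractivity *)

Lemma feedback_linear_near0 : exists2 r, 0 < r &
  exists2 L, 0 <= L & forall y, enorm y <= r -> enorm (k y) <= L * enorm y.
Proof.
have [d d0 [L kL]] : exists2 d, 0 < d & exists L, forall u w, setT u -> setT w
  ->
    enorm (u - 0) < d -> enorm (w - 0) < d -> enorm (k u - k w) <= L * enorm (u
      - w).
  exact: k_lip.
exists (d / 2); first by rewrite divr_gt0.
exists `|L| => // y yd; have := kL y 0 I I; rewrite k0 !subr0 enorm0 => h.
apply: le_trans (h _ d0) _; last by rewrite ler_wpM2r ?enorm_ge0// ler_norm.
by rewrite (le_lt_trans yd)// ltr_pdivrMr// ltr_pMr// ltr1n.
Qed.

(** Continuous dependence on the initial data at the equilibrium. As long as the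
    state stays in a small ball, the right-hand side is at most [C] times the
    largest norm reached so far, so the norm cannot cross an exponential of rate
    [C + 1]. *)
Lemma small_initial_data B rho : 0 < rho -> exists2 delta, 0 < delta &
  forall phi T x, solution tau f k tr t0 phi T x -> tnorm tau phi < delta ->
  forall t, t0 - tau <= t -> t <= B -> (t%:E < T)%E -> enorm (x t) <= rho.
Proof.
move=> rho0; have [r r0 [Lk Lk0 kL]] := feedback_linear_near0.
have [L L0 fL] := @vector_field_growth B 1 ler01.
(* below rho', the linear bound on k holds, and states and inputs are in the unit
   balls on which the linear bound on f holds *)
pose rho' := Num.min (Num.min rho r) (1 / (Lk + 1)).
have Lk1 : 0 < Lk + 1 by rewrite ltr_wpDl.
have rho'0 : 0 < rho' by rewrite !lt_min rho0 r0 divr_gt0.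
have rho'_rho : rho' <= rho by rewrite /rho' !ge_min lexx.
have rho'_r : rho' <= r by rewrite /rho' !ge_min lexx orbT.
have rho'_k : (Lk + 1) * rho' <= 1.
  by rewrite mulrC -ler_pdivlMr// /rho' ge_min lexx orbT.
have rho'_1 : rho' <= 1 by apply: le_trans rho'_k; rewrite ler_pMl// lerDr.
pose C := L * (Lk + 1); have C0 : 0 <= C by rewrite mulr_ge0// ltW.
have C1 : 0 < C + 1 by rewrite ltr_wpDl.
(* the exponential starting from delta at t0 is at most rho' at time B *)
pose delta := rho' * expR (- ((C + 1) * `|B - t0|)).
have delta0 : 0 < delta by rewrite mulr_gt0// expR_gt0.
exists delta => // phi T x sol phid.
pose p t := delta * expR ((C + 1) * (t - t0)).
have p_ge_delta t : t0 <= t -> delta <= p t.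
  move=> t0t; rewrite ler_peMr ?(ltW delta0)// leNgt expR_lt1 -leNgt.
  by rewrite mulr_ge0 ?(ltW C1)// subr_ge0.
have p_mono s t : s <= t -> p s <= p t.
  by move=> st; rewrite ler_pM2l// ler_expR ler_pM2l// lerD2r.
have p_le t : t <= B -> p t <= rho'.
  move=> tB; rewrite /p /delta -mulrA ger_pMr// -expRD expR_le1.
  rewrite addrC -mulrBr pmulr_rle0// subr_le0 (le_trans _ (ler_norm _))//.
  by rewrite lerD2r.
have p_growth s t : s <= t -> p s + (C + 1) * p s * (t - s) <= p t.
  move=> st; have -> : p t = p s * expR ((C + 1) * (t - s)).
    by rewrite /p -mulrA -expRD; congr (_ * expR _); ring.
  have -> : p s + (C + 1) * p s * (t - s) = p s * (1 + (C + 1) * (t - s))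
    by ring.
  by rewrite ler_pM2l ?expR_ge1Dx// mulr_gt0// expR_gt0.
have [_ _ phiE xd] := sol.
have past s : t0 - tau <= s <= t0 -> enorm (x s) <= delta.
  move=> sI; apply: le_trans (ltW phid); rewrite -phiE.
  apply: enorm_le_tnorm_hist sI; apply: (solution_continuous sol) => //.
  by have [] := sol.
have below t : t0 <= t -> t <= B -> (t%:E < T)%E -> enorm (x t) <= p t.
  move=> t0t tB tT; rewrite -subr_ge0.
  apply: (@nonneg_propagation _ t0 t (fun t => p t - enorm (x t))); last
    by rewrite t0t lexx.
  - apply: within_continuousB.
      apply: continuous_subspaceT => s; apply: cvgM; first exact: cvg_cst.
      apply: (@continuous_comp _ _ _ (fun t => (C + 1) * (t - t0)) expR).
        exact: affine_continuous.
      exact: continuous_expR.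
    apply: within_continuous_enorm; apply: (solution_continuous sol) => //.
    by rewrite gerBl.
  - rewrite subr_ge0; apply: le_trans (p_ge_delta _ (lexx _)).
    by apply: past; rewrite lexx gerBl tau_ge0.
  move=> s /andP[t0s st] /eqP; rewrite subr_eq0 => /eqP xp before.
  have sT : (s%:E < T)%E by rewrite (lt_trans _ tT)// lte_fin.
  have sB : s <= B := le_trans (ltW st) tB.
  have upto v : t0 - tau <= v -> v <= s -> enorm (x v) <= p s.
    move=> v1 v2; have [t0v|vt0] := leP t0 v; last first.
      by apply: le_trans (p_ge_delta _ t0s); apply: past; rewrite v1 ltW.
    have := before v; rewrite t0v v2 subr_ge0 => /(_ isT)/le_trans; apply.
    exact: p_mono.
  have [i [/andP[iu _] +]] := xd s t0s sT; rewrite closed_loop_eqE => xs.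
  have /andP[h1 h2] := fine_event_time iu.
  set xi := x _ in xs.
  have xip : enorm xi <= p s by apply: upto => //;
    rewrite (le_trans _ h1)// gerBl.
  have kxi : enorm (k xi) <= Lk * p s.
    apply: le_trans (kL _ _) _; last by rewrite ler_wpM2l.
    exact: le_trans xip (le_trans (p_le s sB) rho'_r).
  have histp : tnorm tau (hist tau x s) <= p s.
    apply: tnorm_hist_le => // v /andP[v1 v2]; apply: upto => //.
    by apply: le_trans v1; rewrite lerD2r.
  have ps0 : 0 < p s by rewrite mulr_gt0// expR_gt0.
  have Lkp : (Lk + 1) * p s <= 1.
    by apply: le_trans rho'_k; rewrite ler_pM2l// p_le.
  have [|d d0 grow] := rderiv_growth (M := (C + 1) * p s) xs.
    apply: le_lt_trans (fL _ _ _ _ (solution_hist_Cseg sol t0s sT) _ _) _.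
    - by rewrite (le_trans t0_ge0 t0s).
    - by rewrite (le_trans histp)// (le_trans (p_le s sB)).
    - by apply: le_trans kxi _; nra.
    apply: (@le_lt_trans _ _ (C * p s)); last by rewrite ltr_pM2r// ltrDl.
    by rewrite /C -mulrA ler_wpM2l// mulrDl mul1r addrC lerD.
  exists d => // v /[dup] sv /andP[/ltW lesv _] _; rewrite subr_ge0.
  apply: le_trans (p_growth s v lesv); rewrite -{1}(subrKC (x s) (x v)).
  by rewrite (le_trans (enormD _ _))// -xp lerD2l grow.
move=> t t1 tB tT; have [t0t|tt0] := leP t0 t.
  exact: le_trans (below t t0t tB tT) (le_trans (p_le t tB) rho'_rho).
apply: (@le_trans _ _ delta); first by apply: past; rewrite t1 ltW.
apply: le_trans rho'_rho; rewrite ger_pMr// expR_le1 oppr_le0.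
by rewrite mulr_ge0// ltW.
Qed.

(** The threshold does not become small with the initial data, but it does in time.
    So the initial data are taken small enough for the state to remain small
    until the threshold is negligible, and from then on the Lyapunov functional
    cannot leave a small sublevel set. *)
Lemma event_triggered_stable : stable tau f k tr t0.
Proof.
move=> eps eps0; have /andP[_ sm] := sigma_bounds.
have lam0 : 0 < mu - sigma by rewrite subr_gt0.
pose K := alpha1 eps / 2; have K0 : 0 < K by rewrite divr_gt0// classK_gt0.
have Keps y : 0 <= y -> alpha1 y <= K -> y < eps.
  move=> y0 yK; apply: (classK_lt_reflect alpha1_K (ltW eps0)).
  apply: le_lt_trans yK _; rewrite ltr_pdivrMr// ltr_pMr ?ltr1n//.
  exact: classK_gt0.
have [B t0B thrB] := threshold_small (mulr_gt0 lam0 K0).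
have K2 : 0 < K / 2 by rewrite divr_gt0.
have [r2 r20 alpha2K] := classK_small alpha2_K K2.
have [r3 r30 alpha3K] := classK_small alpha3_K K2.
pose rho := Num.min eps (Num.min r2 r3) / 2.
have rho0 : 0 < rho by rewrite divr_gt0// !lt_min eps0 r20.
have rho_lt c : Num.min eps (Num.min r2 r3) <= c -> rho < c.
  by move=> h; rewrite (lt_le_trans _ h)// ltr_pdivrMr// ltr_pMr ?ltr1n//
    !lt_min eps0 r20.
have [delta delta0 small] := @small_initial_data B rho rho0.
exists delta => // phi _ phid T x sol t t0t tT.
have [tB|Bt] := leP t B.
  apply: le_lt_trans (small phi T x sol phid t _ tB tT) _.
    by rewrite (le_trans _ t0t)// gerBl.
  by apply: rho_lt; rewrite ge_min lexx.
have BT : (B%:E < T)%E by rewrite (lt_trans _ tT)// lte_fin.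
apply: Keps; first exact: enorm_ge0.
apply: le_trans (lyapunov_ge sol t0t tT) _.
apply: (lyapunov_invariant sol t0B BT _ thrB (ltW Bt) tT).
have xB : enorm (x B) <= rho by apply: small sol phid _ _ _ _ => //;
  rewrite (le_trans _ t0B)// gerBl.
have hB : tnorm tau (hist tau x B) <= rho.
  apply: tnorm_hist_le => // s /andP[s1 s2]; apply: small sol phid _ _ _ _ =>
    //.
    by apply: le_trans s1; rewrite lerD2r.
  by rewrite (le_lt_trans _ BT)// lee_fin.
apply: le_trans (lyapunov_le sol t0B BT) _.
rewrite (splitr K) lerD// ltW//.
  apply: alpha2K; first exact: enorm_ge0.
  by rewrite (le_lt_trans xB)// rho_lt// !ge_min lexx orbT.
apply: alpha3K; first by apply: tnorm_ge0 => //;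
  exact: solution_hist_Cseg sol _ _ _.
by rewrite (le_lt_trans hB)// rho_lt// !ge_min lexx !orbT.
Qed.

(** Once the threshold is below half of the dissipation on the level [eta], the
    functional decreases at a fixed rate as long as it exceeds [eta]. *)
Lemma event_triggered_attractive : globally_attractive tau f k tr t0.
Proof.
move=> phi _ x sol; apply/cvgrPdist_lt => eps eps0; have /andP[_ sm] :=
  sigma_bounds.
have lam0 : 0 < mu - sigma by rewrite subr_gt0.
pose eta := alpha1 eps / 2; have eta0 : 0 < eta
  by rewrite divr_gt0// classK_gt0.
have lameta : 0 < (mu - sigma) * eta by rewrite mulr_gt0.
have [|s t0s thrs] := @threshold_small ((mu - sigma) * eta / 2).
  by rewrite divr_gt0.
(* half of what the forcing leaves of the dissipation on the level eta *)
pose rate := (mu - sigma) * eta / 4; have rate0 : 0 < rate by rewrite divr_gt0.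
have fin (r : R) : (r%:E < +oo)%E by exact: ltry.
have [K WK] := lyapunov_bounded sol.
exists (s + `|K| / rate); split; first exact: num_real.
move=> t st; rewrite sub0r normrN ger0_norm ?enorm_ge0//.
have s_le_t : s <= t.
  by apply: le_trans (ltW st); rewrite lerDl divr_ge0// ltW.
have t0t := le_trans t0s s_le_t.
suff Wt : lyapunov x t <= eta.
  apply: (classK_lt_reflect alpha1_K (ltW eps0)).
  apply: le_lt_trans (le_trans (lyapunov_ge sol t0t (fin t)) Wt) _.
  rewrite ltr_pdivrMr// ltr_pMr ?ltr1n//; exact: classK_gt0.
rewrite leNgt; apply/negP => Wt.
have above r : s <= r <= t -> eta < lyapunov x r.
  move=> /andP[sr rt]; rewrite ltNge; apply/negP => Wr.
  move: Wt; rewrite ltNge => /negP; apply.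
  apply: (lyapunov_invariant sol (le_trans t0s sr) (fin r) Wr _ rt (fin t)).
  apply: le_lt_trans (threshold_le sr) _; apply: lt_trans thrs _.
  by rewrite ltr_pdivrMr// ltr_pMr ?ltr1n.
have : lyapunov x t <= K - rate * (t - s).
  apply: (lyapunov_barrier (p := fun r => K - rate * (r - s)) sol t0s (fin t));
    last by rewrite s_le_t lexx.
  - apply: within_continuousB; apply: continuous_subspaceT.
      by move=> ?; exact: cst_continuous.
    exact: affine_continuous.
  - by rewrite subrr mulr0 subr0; exact: WK.
  move=> r /andP[sr rt] WE; exists (- rate) => [|u ru]; last by lra.
  have thr := threshold_le sr.
  have Wr : eta < lyapunov x r by apply: above; rewrite sr ltW.
  have : (mu - sigma) * eta < (mu - sigma) * lyapunov x r by rewrite ltr_pM2l.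
  by rewrite -WE /rate in lameta *; lra.
have : K < rate * (t - s).
  rewrite mulrC -ltr_pdivrMr// ltrBrDl; apply: le_lt_trans st.
  by rewrite lerD2l ler_wpM2r ?invr_ge0 ?ler_norm// ltW.
by move: (lt_trans eta0 Wt); lra.
Qed.

(** * Continuation of solutions *)

(** Restart at time [T], where [e] is the last event so far. Whether or not
    the triggering rule calls for a new sample at [T], the sample held from [T] on
    is one for which the rule is not met at [T], so by continuity no event occurs
    for a while. The event number [j] is located in all continuations of [z],
    because event times are only defined for a trajectory with its horizon. *)
Lemma restart (T : R) z phi j e : t0 <= T ->
  {within `[t0 - tau, T], continuous z} -> hist tau z t0 = phi ->
  (forall t, t0 <= t -> t < T -> driven tau f k tr t0 T%:E z t) ->
  t0 <= e <= T ->
  (forall T' w, (T%:E < T')%E -> (forall s, t0 - tau <= s <= T -> w s = z s) ->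
     ev T' w j = e%:E) ->
  (forall t, e <= t -> t < T -> ~ tr t (sampling_error (z e) z t) (z t)) ->
  exists T' y, [/\ T < T', solution tau f k tr t0 phi T'%:E y &
    forall s, t0 - tau <= s <= T -> y s = z s].
Proof.
move=> t0T zc phiE zd /andP[t0e eT] eE quiet.
have t0tau : t0 - tau <= t0 by rewrite gerBl.
have TtauT : T - tau <= T by rewrite gerBl.
pose now := tr T (sampling_error (z e) z T) (z T).
have [xi [gapT xiE]] : exists xi, trigger_gap xi z T != 0 /\
    ((now /\ xi = z T) \/ (~ now /\ xi = z e)).
  have [trT|ntrT] := pselect now.
    by exists (z T); split; [rewrite lt_eqF// trigger_gap_sample|left].
  by exists (z e); split; [apply/eqP => /triggerP|right].
have [T2 [y [TT2 yc yhist ydyn]]] : exists T2 y,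
    held_solution tau f k xi T (hist tau z T) T2 y.
  apply: solvable (le_trans t0_ge0 t0T) _; apply: hist_Cseg.
  apply: continuous_subspaceW zc => s /=; rewrite !in_itv/= => /andP[s1 ->].
  by rewrite andbT (le_trans _ s1)// lerD2r.
have yz s : T - tau <= s <= T -> y s = z s.
  move=> /andP[s1 s2]; have sI : - tau <= s - T <= 0.
    by rewrite lerBrDl s1 subr_le0.
  by have := congr1 (@^~ (s - T)) yhist; rewrite !histE// subrKC.
pose w s := if s <= T then z s else y s.
have wz s : s <= T -> w s = z s by rewrite /w => ->.
have wy s : T - tau <= s -> w s = y s.
  by move=> s1; rewrite /w; case: ifP => // s2; rewrite yz// s1.
have wc : {within [set t | t0 - tau <= t /\ (t%:E < T2%:E)%E], continuous w}.
  move/within_continuous_enormP : zc => zc;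
    move/within_continuous_enormP : yc => yc.
  apply/within_continuous_enormP => t [t1]; rewrite lte_fin => tT2 r r0.
  have [tT|Tt] := ltP t T.
    have [|d d0 h] := zc t _ r r0; first by rewrite /= in_itv/= t1 ltW.
    exists (Num.min d (T - t)) => [|s [s1 _]]; first
      by rewrite lt_min d0 subr_gt0.
    rewrite lt_min => /andP[sd sT].
    have {}sT : s <= T.
      by move: sT => /(le_lt_trans (ler_norm _)); rewrite ltrD2r => /ltW.
    by rewrite !wz ?(ltW tT)//; apply: h => //; rewrite /= in_itv/= s1.
  have [|d d0 h] := yc t _ r r0; first
    by rewrite /= in_itv/= tT2 (le_trans TtauT).
  exists (Num.min d tau) => [|s [_]]; first by rewrite lt_min d0.
  rewrite lte_fin => sT2; rewrite lt_min => /andP[sd st].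
  have sT : T - tau <= s.
    rewrite lerBlDr (le_trans Tt)// -lerBlDl ltW// (le_lt_trans _ st)//.
    by rewrite distrC ler_norm.
  rewrite !wy// ?(le_trans TtauT)//; apply: h => //.
  by rewrite /= in_itv/= sT.
have [T3 [TT3 T3T2 no_trigger]] : exists T3, [/\ T < T3, T3 <= T2 &
    forall t, T <= t -> t < T3 -> ~ tr t (sampling_error xi w t) (w t)].
  have gapc : {within `[T, T2[, continuous (trigger_gap xi w)}.
    apply: trigger_gap_continuous; apply: continuous_subspaceW wc => s /=.
    by rewrite in_itv/= lte_fin => /andP[s1 ->];
      rewrite (le_trans _ s1)// (le_trans _ t0T).
  have {}gapT : trigger_gap xi w T != 0 by rewrite /trigger_gap wz.
  move/within_continuous_distP : gapc => gapc.
  have [||d d0 h] := gapc T _ `|trigger_gap xi w T|.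
  - by rewrite /= in_itv/= lexx.
  - by rewrite normr_gt0.
  exists (Num.min (T + d) T2); split; first by rewrite lt_min ltrDl d0.
    by rewrite ge_min lexx orbT.
  move=> t Tt; rewrite lt_min => /andP[td tT2] /triggerP gap0.
  have := h t; rewrite /= in_itv/= Tt tT2 gap0 sub0r normrN ltxx => /(_ isT).
  by rewrite ger0_norm ?subr_ge0// ltrBlDl => /(_ td).
have wz' s : t0 - tau <= s <= T -> w s = z s by case/andP => _; exact: wz.
have evj : ev T3%:E w j = e%:E by apply: eE => //; rewrite lte_fin.
have quiet' t : e <= t -> t < T -> ~ tr t (sampling_error (w e) w t) (w t).
  by move=> et tT; rewrite /sampling_error !wz ?(ltW tT)//; exact: quiet.
(* event j is the last one before T3, unless the rule is met at T, which makes T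
   the event number j + 1 *)
have [i [iT T3S xiw]] : exists i, [/\ (ev T3%:E w i <= T%:E)%E,
    (T3%:E <= ev T3%:E w i.+1)%E & w (fine (ev T3%:E w i)) = xi].
  case: xiE => -[trT xiE]; last first.
    exists j; split; rewrite ?evj ?lee_fin//=; last by rewrite wz.
    apply: event_timeS_ge => t []; rewrite evj lee_fin /= => et tT3.
    have [tT|Tt] := ltP t T; first by move/(quiet' t et tT).
    by rewrite wz// -xiE => /no_trigger; case=> //; rewrite -lte_fin.
  have evS : ev T3%:E w j.+1 = T%:E.
    apply/eqP; rewrite eq_le; apply/andP; split.
      apply: event_timeS_le; split; rewrite ?evj ?lee_fin ?lte_fin//=.
      by rewrite /sampling_error !wz.
    apply: event_timeS_ge => t []; rewrite evj !lee_fin /= => et _ trt.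
    by rewrite leNgt; apply/negP => tT; exact: quiet' trt.
  exists j.+1; split; rewrite ?evS//; last by rewrite [fine _]/= wz.
  apply: event_timeS_ge => t []; rewrite evS lee_fin /= wz// -xiE => Tt tT3.
  by move=> /no_trigger; case=> //; rewrite -lte_fin.
exists T3, w; split => //; split.
- by rewrite lte_fin (le_lt_trans t0T).
- apply: continuous_subspaceW wc => s /= [s1 s2]; split => //.
  by rewrite (lt_le_trans s2)// lee_fin.
- by rewrite -phiE; apply: eq_hist => s /andP[_ s2]; rewrite wz// (le_trans s2).
move=> t t0t tT3; have [tT|Tt] := ltP t T.
  apply: (driven_local (c := T%:E) _ _ _ _ _ _ (zd t t0t tT)) => //.
    by rewrite lee_fin ltW.
  by move=> s _; rewrite lte_fin => sT; rewrite wz// ltW.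
exists i; split; first by rewrite (le_trans iT) ?lee_fin//= (lt_le_trans tT3).
rewrite xiw; apply: (closed_loop_eq_local _ tT3 _ (ydyn t Tt _)) => //.
  by move=> s s1 _; rewrite wy// (le_trans _ s1)// lerD2r.
by apply: lt_le_trans T3T2; rewrite -lte_fin.
Qed.

(** The initial time is a restart without any past event but the initial one. *)
Lemma local_existence phi : Cseg tau phi ->
  exists (T : R) x, solution tau f k tr t0 phi T%:E x.
Proof.
move=> phiC; pose z s := phi (s - t0).
have [|||||||T' [x [_ sol _]]] := @restart t0 z phi 0 t0.
- exact: lexx.
- have [/within_continuous_enormP phic _] := phiC.
  apply/within_continuous_enormP => t; rewrite /= in_itv/= => /andP[t1 t2] r r0.
  have shift s : t0 - tau <= s <= t0 -> `[- tau, 0]%classic (s - t0).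
    by move=> /andP[s1 s2]; rewrite /= in_itv/= lerBrDl s1 subr_le0.
  have [|d d0 h] := phic (t - t0) _ r r0; first by apply: shift; rewrite t1.
  exists d => // s; rewrite in_itv/= => sI st; apply: h; first exact: shift.
  by rewrite opprB addrA subrK.
- rewrite -(hist_id phiC); apply/funext => s; rewrite /hist /patch.
  by case: ifP => // _; rewrite /z add0r addrAC subrr add0r.
- by move=> t t0t tt0; move: (le_lt_trans t0t tt0); rewrite ltxx.
- by rewrite lexx.
- by [].
- by move=> t t0t tt0; move: (le_lt_trans t0t tt0); rewrite ltxx.
by exists T', x.
Qed.

(** A solution on [t0, T[ is Lipschitz, hence has a limit at [T], and it has only
    finitely many events; so it can be restarted at [T]. *)
Lemma extend_solution (T : R) phi x : solution tau f k tr t0 phi T%:E x ->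
  exists T' y, [/\ T < T', solution tau f k tr t0 phi T'%:E y &
    forall s, t0 - tau <= s -> s < T -> y s = x s].
Proof.
move=> sol; have [t0T _ phiE xd] := sol; rewrite lte_fin in t0T.
have [M M0 xM] := trajectory_lipschitz sol T.
have [|l xl] := @lipschitz_left_limit _ _ x t0 T M t0T.
  by move=> s t t0s st tT; apply: xM => //; exact: ltW.
pose z s := if s < T then x s else l.
have zx s : s < T -> z s = x s by rewrite /z => ->.
have zc : {within `[t0 - tau, T], continuous z}.
  apply/within_continuous_enormP => t; rewrite /= in_itv/= => /andP[t1 t2] r r0.
  move: t2; rewrite le_eqVlt => /predU1P[->|tT].
    exists (Num.min (T - t0) (r / M)) => [|s].
      by rewrite lt_min subr_gt0 t0T divr_gt0.
    rewrite in_itv/= => /andP[_]; rewrite le_eqVlt => /predU1P[->|sT].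
      by move=> _; rewrite (subrr (z T)) enorm0.
    rewrite zx// {1}/z ltxx enorm_distC distrC ger0_norm ?subr_ge0 ?(ltW sT)//.
    rewrite lt_min => /andP[/ltW + sr]; rewrite lerD2l lerN2 => t0s.
    apply: le_lt_trans (xl s t0s sT) _.
    by rewrite mulrC -ltr_pdivlMr.
  pose c := (t + T) / 2; have [tc cT] := midf_lt tT.
  have /within_continuous_enormP xc : {within `[t0 - tau, c], continuous x}.
    by apply: (solution_continuous sol); rewrite ?lte_fin.
  have [|d d0 h] := xc t _ r r0; first by rewrite /= in_itv/= t1 ltW.
  exists (Num.min d (c - t)) => [|s]; first by rewrite lt_min d0 subr_gt0.
  rewrite in_itv/= lt_min => /andP[s1 _] /andP[sd sc].
  have {}sc : s <= c.
    by move: sc => /(le_lt_trans (ler_norm _)); rewrite ltrD2r => /ltW.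
  rewrite !zx//; last exact: le_lt_trans cT.
  by apply: h => //; rewrite /= in_itv/= s1.
have [N few] := finitely_many_events sol T.
have ex0 : exists i, (ev T%:E x i < T%:E)%E by exists 0; rewrite lte_fin.
have bnd i : (ev T%:E x i < T%:E)%E -> (i <= N)%N by move=> /ltW/few/ltnW.
have [j jT jmax] := ex_maxnP ex0 bnd.
have je := event_time_fineK (ltW jT); have := fine_event_time (ltW jT).
set e := fine _ in je *; move=> /andP[t0e _].
have eT : e < T by rewrite -lte_fin je.
have [|||||||T' [y [TT' soly yz]]] := @restart T z phi j e => //.
- exact: ltW.
- by rewrite -phiE; apply: eq_hist => s /andP[_ s2];
    rewrite zx// (le_lt_trans s2).
- move=> t t0t tT; apply: (driven_local (c :=
    T%:E) _ _ _ _ _ _ (xd t t0t _)) => //.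
  by move=> s _ sT; rewrite zx// -lte_fin.
- by rewrite t0e ltW.
- move=> T' w TT' wz; rewrite je; apply: event_time_local (ltW TT') _ jT => //.
  move=> t t0t; rewrite lte_fin => tT; rewrite wz ?zx// (ltW tT) andbT.
  by rewrite (le_trans _ t0t)// gerBl.
- move=> t et tT; rewrite /sampling_error !zx// => trt.
  have : (ev T%:E x j.+1 < T%:E)%E.
    apply: (@le_lt_trans _ _ t%:E); last by rewrite lte_fin.
    by apply: event_timeS_le; split; rewrite ?lte_fin// -je lee_fin.
  by move=> /jmax; rewrite ltnn.
by exists T', y; split => // s s1 sT; rewrite yz ?zx// s1 ltW.
Qed.

(** Solutions ordered by extension form a set in which every chain has an upper
    bound, the union of its members; and a solution with a finite horizon is not
    maximal. *)
Lemma global_existence phi : Cseg tau phi ->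
  exists x, solution tau f k tr t0 phi +oo%E x.
Proof.
move=> phiC.
pose P := {p : \bar R * (R -> 'rV[R]_n) | solution tau f k tr t0 phi p.1 p.2}.
pose ext (p q : P) := ((sval p).1 <= (sval q).1)%E /\
  forall s, t0 - tau <= s -> (s%:E < (sval p).1)%E -> (sval q).2 s = (sval p).2
    s.
have [T0 [x0 sol0]] := local_existence phiC.
have p0 : P by exists (T0%:E, x0).
have [||A Atot|[[T x] /= sol] maxp] := @ZL_preorder P p0 (fun p q =>
  `[< ext p q >]).
- by move=> p; apply/asboolP; split.
- move=> q p r /asboolP[qp pq] /asboolP[qr rq]; apply/asboolP.
  split=> [|s s1 sp]; first exact: le_trans qr.
  by rewrite rq ?pq// (lt_le_trans sp).
- have [A0|/set0P[q0 Aq0]] := eqVneq A set0; first by exists p0 => q;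
    rewrite A0.
  pose Ts := ereal_sup [set (sval p).1 | p in A].
  have ATs p : A p -> ((sval p).1 <= Ts)%E by move=> Ap;
    apply: ereal_sup_ubound; exists p.
  pose xs s := if pselect (exists p, A p /\ (s%:E < (sval p).1)%E) is left h
    then (sval (sval (cid h))).2 s else 0.
  have xsE p s : A p -> t0 - tau <= s -> (s%:E < (sval p).1)%E -> xs s = (sval
    p).2 s.
    move=> Ap s1 sp; rewrite /xs; case: pselect => [h|[]]; last by exists p.
    case: cid => /= q [Aq sq].
    by have [/asboolP[_ qp]|/asboolP[_ pq]] := Atot q p Aq Ap;
      [rewrite qp|rewrite pq].
  have TsA s : (s%:E < Ts)%E -> exists2 p, A p & (s%:E < (sval p).1)%E.
    by move=> /ereal_sup_gt[_ [p Ap <-] sp]; exists p.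
  have sols : solution tau f k tr t0 phi Ts xs.
    have [t0q _ q0phi _] := svalP q0.
    split; first exact: lt_le_trans (ATs _ Aq0).
    + apply/within_continuous_enormP => t [t1 tTs] r r0.
      have [p Ap tp] := TsA t tTs; have [_ pc _ _] := svalP p.
      have [c tc cp] : exists2 c : R, t < c & (c%:E <= (sval p).1)%E.
        case: (sval p).1 tp => [u| |//]; last by exists (t + 1);
          rewrite ?leey ?ltrDl.
        by rewrite lte_fin => tu; exists u.
      move/within_continuous_enormP : pc => /(_ t (conj t1 tp) r r0)[d d0 h].
      exists (Num.min d (c - t)) => [|s [s1 _]]; first
        by rewrite lt_min d0 subr_gt0.
      rewrite lt_min => /andP[sd /(le_lt_trans (ler_norm _))];
        rewrite ltrD2r => sc.
      have sp : (s%:E < (sval p).1)%E by rewrite (lt_le_trans _ cp)// lte_fin.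
      by rewrite !(xsE p)//; apply: h.
    + rewrite -q0phi; apply: eq_hist => s /andP[s1 s2]; apply: xsE => //.
      by rewrite (le_lt_trans _ t0q)// lee_fin.
    move=> t t0t tTs; have [p Ap tp] := TsA t tTs; have [_ _ _ pd] := svalP p.
    apply: (driven_local (c := (sval p).1) _ _ _ _ _ _ (pd t t0t tp)) => //.
      exact: ATs.
    by move=> s s1 sp; apply/esym/xsE.
  exists (exist _ (Ts, xs) sols) => p Ap; apply/asboolP; split;
    first exact: ATs.
  by move=> s s1 sp; apply: xsE.
case: T sol maxp => [T| |] sol maxp; [|by exists x|by have [] := sol].
have [T' [y [TT' soly yx]]] := extend_solution sol.
have /maxp/asboolP[/=] : `[< ext (exist _ (T%:E, x) sol) (exist _ (T'%:E, y)
  soly) >].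
  apply/asboolP; split; first by rewrite /= lee_fin ltW.
  by move=> s s1 sT; apply: yx; rewrite -?lte_fin.
by rewrite lee_fin leNgt TT'.
Qed.

Lemma event_triggered_complete : forward_complete tau f k tr t0.
Proof.
move=> phi phiC; split; first exact: global_existence.
case=> [T| |] x [sol maxx]; [|by []|by have [] := sol].
have [T' [y [TT' soly yx]]] := extend_solution sol.
have := maxx _ _ soly; rewrite lee_fin => /(_ (ltW TT')) h.
have TE : T'%:E = T%:E by apply: h => t t1 tT; apply: yx; rewrite -?lte_fin.
by move: TT'; rewrite -lte_fin TE ltxx.
Qed.

End EventTriggeredLoop.

Unset Implicit Arguments.

Theorem theorem1 (R : realType) (n m : nat) (tau : R)
  (f : R -> (R -> 'rV[R]_n) -> 'rV[R]_m -> 'rV[R]_n)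
  (k : 'rV[R]_n -> 'rV[R]_m)
  (V1 : R -> 'rV[R]_n -> R) (V2 : R -> (R -> 'rV[R]_n) -> R)
  (alpha1 alpha2 alpha3 chi : R -> R) (mu sigma a b t0 : R)
  (tau_gt0 : 0 < tau)
  (f0 : forall t, 0 <= t -> f t (fun=> 0) 0 = 0)
  (k0 : k 0 = 0)
  (solvable : locally_solvable tau f k)
  (V1_V0 : classV0 V1) (V2_V0star : classV0star tau V2)
  (alpha1_Kinf : classKinf alpha1) (alpha2_Kinf : classKinf alpha2)
  (alpha3_Kinf : classKinf alpha3) (chi_K : classK chi) (mu_gt0 : 0 < mu)
  (V1_bounds : forall t phi, 0 <= t -> Cseg tau phi ->
     alpha1 (enorm (phi 0)) <= V1 t (phi 0) <= alpha2 (enorm (phi 0)))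
  (V2_bounds : forall t phi, 0 <= t -> Cseg tau phi ->
     0 <= V2 t phi <= alpha3 (tnorm tau phi))
  (V_dissipation :
     dissipation tau f k (fun t phi => V1 t (phi 0) + V2 t phi) mu chi)
  (t0_ge0 : 0 <= t0) (sigma_bounds : 0 <= sigma < mu)
  (a_gt0 : 0 < a) (b_gt0 : 0 < b)
  (alpha1inv_lip : locally_lipschitz Num.norm Num.norm `[0, +oo[%classic
     (Kinv alpha1))
  (chi_lip : locally_lipschitz Num.norm Num.norm `[0, +oo[%classic chi)
  (k_lip : locally_lipschitz (@enorm R n) (@enorm R m) setT k)
  (f_lip_state : lipschitz_in_state tau f)
  (f_lip_input : lipschitz_in_input tau f) :
  globally_asymptotically_stable tau f k (trigger alpha1 chi sigma a b t0) t0 /\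
  (forall phi T x, Cseg tau phi ->
     solution tau f k (trigger alpha1 chi sigma a b t0) t0 phi T x ->
     ~ zeno (trigger alpha1 chi sigma a b t0) t0 T x).
Proof.
split; last first.
  move=> phi T x _ sol.
  exact: (not_zeno tau_gt0 f0 V1_V0 V2_V0star alpha1_Kinf chi_K V1_bounds V2_bounds
    V_dissipation t0_ge0 sigma_bounds a_gt0 b_gt0 k_lip f_lip_state f_lip_input sol).
split.
- exact: (event_triggered_complete tau_gt0 f0 solvable V1_V0 V2_V0star alpha1_Kinf
    chi_K V1_bounds V2_bounds V_dissipation t0_ge0 sigma_bounds a_gt0 b_gt0 k_lip
    f_lip_state f_lip_input).
- exact: (event_triggered_stable tau_gt0 f0 k0 V1_V0 V2_V0star alpha1_Kinf
    alpha2_Kinf.1 alpha3_Kinf.1 chi_K V1_bounds V2_bounds V_dissipation t0_ge0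
    sigma_bounds a_gt0 b_gt0 k_lip f_lip_state f_lip_input).
- exact: (event_triggered_attractive tau_gt0 V1_V0 V2_V0star alpha1_Kinf chi_K
    V1_bounds V2_bounds V_dissipation t0_ge0 sigma_bounds a_gt0 b_gt0).
Qed.
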